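(* One has $N_9=32$.
   Context: Let $\sigma$ be the normalized (probability) surface measure on $S^2\subset\mathbb R^3$. A positive cubature formula of degree $t$ consists of distinct nodes $x_1,\dots,x_N\in S^2$ and weights $w_i>0$ with $\int_{S^2} f\,d\sigma=\sum_i w_i f(x_i)$ for every real polynomial $f$ of total degree at most $t$. $N_t$ is the least possible number of nodes of a positive cubature formula of degree $t$ on $S^2$. *)

(* Defs.v *)
From HB Require Import structures.
From mathcomp Require Import all_boot all_order all_algebra.
(* Without its notations, which clash with those of mathcomp-analysis, and
   first, since both define a module Measure. *)
From mathcomp Require Import -(notations) mpoly.
From mathcomp Require Import all_classical all_reals all_analysis.
From mathcomp Require Import measurable_realfun.
From mathcomp Require Import ring.

Set Implicit Arguments.
Unset Strict Implicit.
Unset Printing Implicit Defensive.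

Import Order.TTheory GRing.Theory Num.Theory.
Import numFieldNormedType.Exports.

Local Open Scope classical_set_scope.
Local Open Scope ring_scope.

Definition sphere2 {R : realType} : set (3.-tuple R) :=
  [set x | \sum_(i < 3) tnth x i ^+ 2 = 1].

(* p.1 is the polar angle, p.2 the azimuth. *)
Definition spherical {R : realType} (p : R * R) : 3.-tuple R :=
  [tuple sin p.1 * cos p.2; sin p.1 * sin p.2; cos p.1].

Definition angle_box {R : realType} : set (R * R) :=
  `[0, pi] `*` `[0, 2 * pi].

(* The area element of [spherical], i.e., the norm of the cross product of its
   partial derivatives, is sin p.1 on [angle_box]; the total area is 4 pi. *)
Definition area_density {R : realType} : R * R -> R :=
  (fun p => sin p.1 / (4 * pi)) \_ angle_box.

Definition sphere_measure {R : realType} (A : set (3.-tuple R)) : \bar R :=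
  (\int[(@lebesgue_measure R \x @lebesgue_measure R)%E]_(p in spherical @^-1` A)
     (area_density p)%:E)%E.

Section sphere_measure.
Context {R : realType}.
Local Open Scope ereal_scope.
Local Notation mu := (@lebesgue_measure R).

Lemma measurable_spherical :
  measurable_fun [set: R * R] (spherical : _ -> 3.-tuple R).
Proof.
have m1 (f : R -> R) : continuous f ->
    measurable_fun [set: R * R] (fun p => f p.1).
  by move=> cf; apply: measurableT_comp => //; exact: continuous_measurable_fun.
have m2 (f : R -> R) : continuous f ->
    measurable_fun [set: R * R] (fun p => f p.2).
  by move=> cf; apply: measurableT_comp => //; exact: continuous_measurable_fun.
apply/measurable_fun_tnthP => -[[|[|[|//]]] ilt].
- rewrite (_ : _ \o _ = (fun p : R * R => sin p.1 * cos p.2)%R)//.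
  apply: measurable_funM; first by apply: (m1 sin); exact: continuous_sin.
  by apply: (m2 cos); exact: continuous_cos.
- rewrite (_ : _ \o _ = (fun p : R * R => sin p.1 * sin p.2)%R)//.
  apply: measurable_funM; first by apply: (m1 sin); exact: continuous_sin.
  by apply: (m2 sin); exact: continuous_sin.
- apply: (m1 cos); exact: continuous_cos.
Qed.

Lemma measurable_angle_box :
  measurable (angle_box : set (R * R)).
Proof. by apply: measurableX; exact: measurable_itv. Qed.

Lemma area_density_ge0 (p : R * R) : (0 <= area_density p)%R.
Proof.
rewrite /area_density patchE; case: ifPn => // /[!inE] -[].
rewrite /= in_itv/= => p1 _.
by rewrite divr_ge0 ?sin_ge0_pi// mulr_ge0// pi_ge0.
Qed.

Lemma measurable_area_density :
  measurable_fun [set: R * R] (EFin \o @area_density R).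
Proof.
apply/measurable_EFinP/(measurable_restrictT _ measurable_angle_box).
apply: measurable_funTS; apply: measurable_funM => //.
apply: measurableT_comp => //.
exact: (continuous_measurable_fun (@continuous_sin R)).
Qed.

Let sphere_measure0 : @sphere_measure R set0 = 0.
Proof. by rewrite /sphere_measure preimage_set0 integral_set0. Qed.

Let sphere_measure_ge0 A : 0 <= @sphere_measure R A.
Proof. by apply: integral_ge0 => p _; rewrite lee_fin area_density_ge0. Qed.

Let sphere_measure_sigma_additive :
  semi_sigma_additive (@sphere_measure R : set (3.-tuple R) -> _).
Proof.
move=> F mF tF mUF; rewrite /sphere_measure preimage_bigcup.
have mpre (A : set (3.-tuple R)) : measurable A ->
    measurable (spherical @^-1` A : set (R * R)).
  by move=> mA; have := measurable_spherical measurableT mA; rewrite setTI.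
have h0 p : 0 <= (EFin \o @area_density R) p.
  by rewrite lee_fin area_density_ge0.
apply: (semi_sigma_additive_nng_induced (mu := (mu \x mu)%E)
          measurable_area_density h0).
- by move=> n; exact: mpre (mF n).
- apply/trivIsetP => /= i j _ _ ij; rewrite -preimage_setI.
  by move/trivIsetP : tF => /(_ _ _ _ _ ij) ->//; rewrite preimage_set0.
- by rewrite -preimage_bigcup; exact: mpre mUF.
Qed.

HB.instance Definition _ := isMeasure.Build _ _ _
  (@sphere_measure R : set (3.-tuple R) -> _)
  sphere_measure0 sphere_measure_ge0 sphere_measure_sigma_additive.

Lemma spherical_sphere (p : R * R) : sphere2 (spherical p).
Proof.
rewrite /sphere2/= !big_ord_recr big_ord0/= add0r.
rewrite !(tnth_nth 0%R)/= !exprMn -mulrDr cos2Dsin2 mulr1.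
by rewrite addrC cos2Dsin2.
Qed.

Let integral_sin : \int[mu]_(x in `[0%R, pi]) (sin x)%:E = 2%:E.
Proof.
rewrite (@continuous_FTC2 _ _ (- cos)%R) ?pi_gt0//.
- by rewrite /= !EFinN cos0 cospi !EFinN oppeK.
- exact/continuous_subspaceT/continuous_sin.
- split.
  + by move=> x x0pi; exact/derivableN/derivable_cos.
  + by apply: cvgN; apply: cvg_at_right_filter; exact: continuous_cos.
  + by apply: cvgN; apply: cvg_at_left_filter; exact: continuous_cos.
  + by move=> x x0pi; rewrite derive1E deriveN// derive_val opprK.
Qed.

Let sphere_measure_setT : @sphere_measure R setT = 1.
Proof.
rewrite /sphere_measure preimage_setT.
have h0 p : 0 <= (EFin \o @area_density R) p.
  by rewrite lee_fin area_density_ge0.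
have -> := fubini_tonelli1 (m1 := mu) (m2 := mu) _ measurable_area_density h0.
rewrite /fubini_F /=.
transitivity (\int[mu]_(x in `[0%R, pi]) ((2^-1)%:E * (sin x)%:E)).
  rewrite [RHS]integral_mkcond; apply: eq_integral => x _.
  rewrite patchE /=.
  transitivity (\int[mu]_(y in `[0%R, (2 * pi)%R])
      (if x \in `[0%R, pi] then (sin x / (4 * pi))%:E else 0)).
    rewrite [RHS]integral_mkcond; apply: eq_integral => y _.
    rewrite /area_density !patchE.
    rewrite /angle_box in_setX/= !mem_setE.
    by case: (x \in _); case: (y \in _).
  rewrite mem_setE; case: (x \in _); last by rewrite integral0.
  rewrite integral_cst//= lebesgue_measure_itv/= lte_fin.
  rewrite mulr_gt0 ?pi_gt0//= -EFinD subr0.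
  rewrite -!EFinM; congr EFin.
  by move: (sin x) (pi_gt0 R) => s; move: pi => c c0; field; rewrite gt_eqF.
rewrite ge0_integralZl//=.
- by rewrite integral_sin -EFinM mulVf.
- apply/measurable_EFinP/measurable_funTS.
  exact: (continuous_measurable_fun (@continuous_sin R)).
- by move=> x; rewrite in_itv/= => x0pi; rewrite lee_fin sin_ge0_pi.
Qed.

HB.instance Definition _ := @Measure_isProbability.Build _ _ _
  (@sphere_measure R : set (3.-tuple R) -> _) sphere_measure_setT.

Lemma sphere_measure_sphere : @sphere_measure R sphere2 = 1.
Proof.
rewrite -sphere_measure_setT /sphere_measure; congr integral.
by apply/seteqP; split => // p _; exact: spherical_sphere.
Qed.

End sphere_measure.

Definition positive_cubature {R : realType} (t N : nat)
    (x : 'I_N -> 3.-tuple R) (w : 'I_N -> R) : Prop :=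
  [/\ injective x,
      forall i, sphere2 (x i),
      forall i, 0 < w i &
      (* [msize f] is the total degree of [f] plus one, and 0 for [f = 0]. *)
      forall f : mpoly 3 R, (msize f <= t.+1)%N ->
        (\int[sphere_measure]_(y in sphere2) (meval (tnth y) f)%:E =
         (\sum_(i < N) w i * meval (tnth (x i)) f)%:E)%E].

Definition has_positive_cubature (R : realType) (t N : nat) : Prop :=
  exists (x : 'I_N -> 3.-tuple R) (w : 'I_N -> R), positive_cubature t x w.

(* The default 0 is never the size of a positive cubature formula, since a
   formula without nodes does not integrate the constant 1. *)
Definition min_nodes (R : realType) (t : nat) : nat :=
  xget 0%N [set N | has_positive_cubature R t N /\
    forall M, has_positive_cubature R t M -> (N <= M)%N].

(* Main.v *)
(* Upper bound: the 12 vertices of a regular icosahedron, with weight 5/168, and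
   the 20 vertices of the dual dodecahedron, with weight 9/280.

   Lower bound. Let X be the nodes of a formula with at most 31 nodes, and let
   E_d be the space of forms of degree d. On X, E_4 (of dimension 15, injective
   on X) is orthogonal to E_5, as products have degree 9 and integral 0. Counting
   dimensions in R^X, this implies that:
   - no plane through 0 contains 6 nodes on distinct lines;
   - among 17 nodes on distinct lines on which E_4 is injective, there are no
     linear relations on E_5: a relation c gives relations c l on E_4 for the
     linear forms l, of which one must vanish since there are only 2 independent
     ones, so that c is supported on a plane, hence on 5 lines, which quintic
     forms separate; but the dimension count yields such a relation.
   So the nodes lie on at most 16 lines, and quintic forms separate these lines.
   As quintic forms have integral 0, opposite nodes have equal weights (a
   missing node having weight 0): X is antipodal, on at most 15 lines. Then the
   reproducing kernel of E_4 vanishes at pairs of non-opposite nodes x, y, i.e.,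
   3 (x.y)^2 - 1 is 2 / sqrt 7 up to sign, while the sum over y of these numbers
   is rational and nonzero. *)
Require Import Defs.
From mathcomp Require Import all_boot all_order all_algebra.
From mathcomp Require Import -(notations) mpoly.
From mathcomp Require Import all_classical all_reals all_analysis.
From mathcomp Require Import measurable_realfun.
From mathcomp Require Import ring lra zify.

Set Implicit Arguments.
Unset Strict Implicit.
Unset Printing Implicit Defensive.

Import Order.TTheory GRing.Theory Num.Theory.
Import numFieldNormedType.Exports.

Local Open Scope ring_scope.

(** * Linear dependence by counting *)

(** With finite types as index sets, functionals of several kinds can be joined in a sum type. *)
Lemma linear_dependence (F : fieldType) (I J : finType) (u : J -> I -> F) :
  (#|I| < #|J|)%N ->
  exists c : J -> F, (exists j, c j != 0) /\ forall i, \sum_j c j * u j i = 0.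
Proof.
move=> IJ; pose A := \matrix_(j < #|J|, i < #|I|) u (enum_val j) (enum_val i).
have : kermx A != 0.
  rewrite -mxrank_eq0 mxrank_ker -lt0n subn_gt0.
  exact: leq_ltn_trans (rank_leq_col A) IJ.
case/rowV0Pn => v /sub_kermxP vA v0.
exists (fun j => v 0 (enum_rank j)); split.
  by have /rV0Pn[j vj] := v0; exists (enum_val j); rewrite enum_valK.
move=> i; have /rowP /(_ (enum_rank i)) := vA.
rewrite !mxE => vAi; rewrite -[RHS]vAi (reindex (@enum_val _ J)) /=; last first.
  exact/onW_bij/enum_val_bij.
by apply: eq_bigr => j _; rewrite mxE enum_rankK enum_valK.
Qed.

(** * Forms in three variables, moments and zonal quartic forms *)

Section forms.
Context {R : realFieldType}.
Implicit Types (a b c d : nat) (u v l y : seq R) (f g : seq R -> R).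

(** Vectors are sequences read at their first three entries, so that 3-tuples and explicit triples
    serve alike. *)
Definition monomial a b c v : R := v`_0 ^+ a * v`_1 ^+ b * v`_2 ^+ c.

(* Double factorials: [odd_fact n] is (n-1)!! and [even_fact n] is n!!, for
   [n] even. *)
Definition odd_fact n : R := \prod_(i < n./2) (i.*2.+1)%:R.
Definition even_fact n : R := \prod_(i < n./2) (i.*2.+2)%:R.

Lemma odd_factS n : odd_fact n.+2 = odd_fact n * (n./2.*2.+1)%:R.
Proof. by rewrite /odd_fact /= big_ord_recr. Qed.

Lemma even_factS n : even_fact n.+2 = even_fact n * (n./2.*2.+2)%:R.
Proof. by rewrite /even_fact /= big_ord_recr. Qed.

Lemma odd_fact_neq0 n : odd_fact n != 0.
Proof. by apply/prodf_neq0 => i _; rewrite pnatr_eq0. Qed.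

Lemma even_fact_neq0 n : even_fact n != 0.
Proof. by apply/prodf_neq0 => i _; rewrite pnatr_eq0. Qed.

(** The integral of the monomial over the sphere, as [integral_monomial] proves: (a-1)!! (b-1)!!
    (c-1)!! / (a+b+c+1)!! for even exponents. *)
Definition moment a b c : R :=
  if [|| odd a, odd b | odd c] then 0
  else odd_fact a * odd_fact b * odd_fact c / odd_fact (a + b + c).+2.

Definition dot u v : R := u`_0 * v`_0 + u`_1 * v`_1 + u`_2 * v`_2.

Definition expt := (nat * nat * nat)%type.
Definition mono (t : expt) v := monomial t.1.1 t.1.2 t.2 v.
Definition tdeg (t : expt) := (t.1.1 + t.1.2 + t.2)%N.

(** Forms are functions; exponents may recur in the list of terms, so that sums concatenate lists
    and products pair them. *)
Definition form d g := exists s : seq (R * expt),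
  all (fun t => tdeg t.2 == d) s /\ forall v, g v = \sum_(t <- s) t.1 * mono t.2 v.

Lemma form_mono t : form (tdeg t) (mono t).
Proof.
by exists [:: (1, t)]; rewrite /= eqxx; split=> // v; rewrite big_seq1 mul1r.
Qed.

Lemma formD d f g : form d f -> form d g -> form d (fun v => f v + g v).
Proof.
move=> [s [sd fE]] [r [rd gE]]; exists (s ++ r); split.
  by rewrite all_cat sd.
by move=> v; rewrite fE gE big_cat.
Qed.

Lemma formZ d k g : form d g -> form d (fun v => k * g v).
Proof.
move=> [s [sd gE]]; exists [seq (k * t.1, t.2) | t <- s]; split.
  by rewrite all_map.
move=> v; rewrite gE big_map mulr_sumr.
by apply: eq_bigr => t _; rewrite mulrA.
Qed.

Definition tadd (p q : expt) : expt :=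
  (p.1.1 + q.1.1, p.1.2 + q.1.2, p.2 + q.2)%N.

Lemma tdegD p q : tdeg (tadd p q) = (tdeg p + tdeg q)%N.
Proof. by rewrite /tdeg /=; lia. Qed.

Lemma monoM p q v : mono p v * mono q v = mono (tadd p q) v.
Proof. by rewrite /mono /monomial /= !exprD; ring. Qed.

Lemma formM d e f g : form d f -> form e g ->
  form (d + e) (fun v => f v * g v).
Proof.
move=> [s [sd fE]] [r [re gE]].
exists [seq (p.1 * q.1, tadd p.2 q.2) | p <- s, q <- r]; split.
  apply/allP => _ /allpairsP[[p q] /= [ps qr ->]].
  move/allP: sd => /(_ p ps) /eqP <-; move/allP: re => /(_ q qr) /eqP <-.
  by rewrite tdegD.
move=> v; rewrite fE gE big_allpairs_dep mulr_suml; apply: eq_bigr => p _.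
by rewrite mulr_sumr; apply: eq_bigr => q _; rewrite -monoM mulrACA.
Qed.

Lemma form_dot l : form 1 (dot l).
Proof.
exists [:: (l`_0, (1, 0, 0)%N); (l`_1, (0, 1, 0)%N); (l`_2, (0, 0, 1)%N)].
split=> // v; rewrite !big_cons big_nil /mono /monomial /dot /=; ring.
Qed.

Definition exponents d : seq expt :=
  [seq (i, j, (d - i - j)%N) | i <- iota 0 d.+1, j <- iota 0 (d.+1 - i)].

Definition comb d (c : 'I_(size (exponents d)) -> R) v : R :=
  \sum_k c k * mono (nth (0, 0, 0)%N (exponents d) k) v.

Lemma exponentsP d t : t \in exponents d -> tdeg t = d.
Proof.
case/allpairsPdep => i [j [+ + ->]]; rewrite !mem_iota /tdeg /=; lia.
Qed.

Lemma exponents_uniq d : uniq (exponents d).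
Proof.
rewrite allpairs_uniq_dep ?iota_uniq//; last by move=> [i j] [i' j'] _ _ [-> ->].
by move=> i _; rewrite iota_uniq.
Qed.

Lemma form_comb d (c : 'I_(size (exponents d)) -> R) : form d (comb c).
Proof.
exists [seq (c k, nth (0, 0, 0)%N (exponents d) k) | k <- enum 'I_(size (exponents d))].
split.
  apply/allP => _ /mapP[k _ ->] /=; apply/eqP/exponentsP/mem_nth/ltn_ord.
by move=> v; rewrite big_map /comb /= big_enum.
Qed.

Lemma horner_eq0 (p : {poly R}) : (forall z, p.[z] = 0) -> p = 0.
Proof.
move=> p0; apply/eqP/negPn/negP => pn0.
have := max_poly_roots pn0 (rs := [seq n%:R : R | n <- iota 0 (size p)]).
rewrite size_map size_iota ltnn.
case/(_ _ _)/Bool.diff_false_true.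
  by apply/allP => _ /mapP[n _ ->]; rewrite rootE p0.
by rewrite map_inj_uniq ?iota_uniq// => m n /eqP; rewrite eqr_nat => /eqP.
Qed.

(* Kronecker substitution v = (1, z, z^(d+1)) separates the monomials. *)
Lemma comb_eq0 d (c : 'I_(size (exponents d)) -> R) :
  (forall v, comb c v = 0) -> forall k, c k = 0.
Proof.
move=> c0 k; pose e (i : 'I_(size (exponents d))) := nth (0, 0, 0)%N (exponents d) i.
pose key i := ((e i).1.2 + d.+1 * (e i).2)%N.
have keyI : injective key.
  move=> i j ij; apply/val_inj/eqP.
  rewrite -(nth_uniq (0, 0, 0)%N _ _ (exponents_uniq d)) //=.
  have ti := exponentsP (mem_nth (0, 0, 0)%N (ltn_ord i)).
  have tj := exponentsP (mem_nth (0, 0, 0)%N (ltn_ord j)).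
  move: ij ti tj; rewrite /key /e /tdeg.
  case: (nth _ _ i) => [[i0 i1] i2]; case: (nth _ _ j) => [[j0 j1] j2] /= ij ti tj.
  have e1 : i1 = j1.
    have := congr1 (modn^~ d.+1) ij; rewrite ![(_ + d.+1 * _)%N]addnC.
    by rewrite ![(d.+1 * _)%N]mulnC !modnMDl !modn_small; lia.
  have e2 : i2 = j2.
    by move: ij; rewrite e1 => /addnI /eqP; rewrite eqn_pmul2l// => /eqP.
  by apply/eqP; congr (_, _, _) => //; lia.
pose p : {poly R} := \sum_i c i *: 'X^(key i).
have p0 : p = 0.
  apply: horner_eq0 => z; rewrite -(c0 [:: 1; z; z ^+ d.+1]) /p horner_sum.
  apply: eq_bigr => i _.
  by rewrite hornerZ hornerXn /mono /monomial /= expr1n mul1r -exprM -exprD.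
have := congr1 (fun q : {poly R} => q`_(key k)) p0.
rewrite /p coef_sum coef0 (bigD1 k)//= coefZ coefXn eqxx mulr1 big1 ?addr0//.
by move=> i ik; rewrite coefZ coefXn (inj_eq keyI) eq_sym (negbTE ik) mulr0.
Qed.

Lemma form_line d f u v : form d f ->
  exists p : {poly R}, forall z,
    p.[z] = f [:: v`_0 + z * u`_0; v`_1 + z * u`_1; v`_2 + z * u`_2].
Proof.
move=> [s [_ fE]]; pose X i : {poly R} := (v`_i)%:P + u`_i *: 'X.
exists (\sum_(t <- s) t.1 *: (X 0%N ^+ t.2.1.1 * X 1%N ^+ t.2.1.2 * X 2%N ^+ t.2.2)).
move=> z; rewrite fE horner_sum; apply: eq_bigr => t _.
rewrite hornerZ !hornerM !horner_exp !hornerD !hornerC !hornerZ !hornerX.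
by rewrite /mono /monomial /= ![_ * z]mulrC.
Qed.

Lemma form_coord d f v : form d f -> f v = f [:: v`_0; v`_1; v`_2].
Proof. by move=> [s [_ fE]]; rewrite !fE; apply: eq_bigr. Qed.

(** On the line v + z l, [dot l] is a polynomial in z with leading coefficient [dot l l], so the
    polynomial of f on this line is 0. *)
Lemma form_mul_dot_eq0 d f l : form d f -> dot l l != 0 ->
  (forall v, dot l v * f v = 0) -> forall v, f v = 0.
Proof.
move=> fd l0 lf v; have [p pE] := form_line l v fd.
pose q : {poly R} := (dot l v)%:P + dot l l *: 'X.
have q0 : q != 0.
  apply/eqP => /(congr1 (fun r : {poly R} => r`_1)); rewrite coefD coefC coefZ coefX.
  by rewrite coef0 add0r mulr1; apply/eqP.
have : q * p = 0.
  apply: horner_eq0 => z; rewrite hornerM pE hornerD hornerC hornerZ hornerX.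
  rewrite -[RHS](lf [:: v`_0 + z * l`_0; v`_1 + z * l`_1; v`_2 + z * l`_2]).
  by rewrite /dot /=; ring.
move/eqP; rewrite mulf_eq0 (negbTE q0) /= => /eqP p0.
by have := pE 0; rewrite p0 horner0 !mul0r !addr0 -(form_coord _ fd).
Qed.

Lemma dot_eq0 v : (dot v v == 0) = [&& v`_0 == 0, v`_1 == 0 & v`_2 == 0].
Proof.
by rewrite /dot -!expr2 !paddr_eq0 ?addr_ge0 ?sqr_ge0// !sqrf_eq0 -andbA.
Qed.

Lemma dotC u v : dot u v = dot v u.
Proof. by rewrite /dot; ring. Qed.

Lemma orthogonal_vector l y : exists v, [/\ dot v v != 0, dot l v = 0 & dot y v = 0].
Proof.
pose u (j : 'I_3) (b : bool) := if b then l`_j else y`_j.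
have [|c [[j cj] cu]] := @linear_dependence _ bool 'I_3 u.
  by rewrite card_bool card_ord.
pose v := mkseq (fun i => c (inord i)) 3.
have vE (k : 'I_3) : v`_k = c k by rewrite nth_mkseq// inord_val.
clearbody v.
have dE k : dot k v = \sum_(j < 3) c j * k`_j.
  by rewrite !big_ord_recl big_ord0 /dot -!vE /=; ring.
exists v; split.
- rewrite dot_eq0; apply: contra cj => /and3P[v0 v1 v2]; rewrite -vE.
  by case: j => -[|[|[|//]]] /=.
- by rewrite dE; exact: (cu true).
- by rewrite dE; exact: (cu false).
Qed.

(* With s = y.v on the unit sphere, this is 8/15 (1 + 5 P_2(s) + 9 P_4(s)), P_l
   being the Legendre polynomials: a multiple of the reproducing kernel of the
   quartic forms. *)
Definition zonal y v : R :=
  21 * dot y v ^+ 4 - 14 * dot y v ^+ 2 * dot y y * dot v v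
  + dot y y ^+ 2 * dot v v ^+ 2.

Definition zonal_terms y : seq (R * expt) :=
  let r := dot y y in let x := y`_0 in let z := y`_1 in let t := y`_2 in
  [:: (21 * x ^+ 4 - 14 * r * x ^+ 2 + r ^+ 2, (4, 0, 0)%N);
      (21 * z ^+ 4 - 14 * r * z ^+ 2 + r ^+ 2, (0, 4, 0)%N);
      (21 * t ^+ 4 - 14 * r * t ^+ 2 + r ^+ 2, (0, 0, 4)%N);
      (84 * x ^+ 3 * z - 28 * r * x * z, (3, 1, 0)%N);
      (84 * x ^+ 3 * t - 28 * r * x * t, (3, 0, 1)%N);
      (84 * z ^+ 3 * x - 28 * r * x * z, (1, 3, 0)%N);
      (84 * z ^+ 3 * t - 28 * r * z * t, (0, 3, 1)%N);
      (84 * t ^+ 3 * x - 28 * r * x * t, (1, 0, 3)%N);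
      (84 * t ^+ 3 * z - 28 * r * z * t, (0, 1, 3)%N);
      (126 * x ^+ 2 * z ^+ 2 - 14 * r * (x ^+ 2 + z ^+ 2) + 2 * r ^+ 2, (2, 2, 0)%N);
      (126 * x ^+ 2 * t ^+ 2 - 14 * r * (x ^+ 2 + t ^+ 2) + 2 * r ^+ 2, (2, 0, 2)%N);
      (126 * z ^+ 2 * t ^+ 2 - 14 * r * (z ^+ 2 + t ^+ 2) + 2 * r ^+ 2, (0, 2, 2)%N);
      (252 * x ^+ 2 * z * t - 28 * r * z * t, (2, 1, 1)%N);
      (252 * z ^+ 2 * x * t - 28 * r * x * t, (1, 2, 1)%N);
      (252 * t ^+ 2 * x * z - 28 * r * x * z, (1, 1, 2)%N)].

Lemma zonalE y v : zonal y v = \sum_(t <- zonal_terms y) t.1 * mono t.2 v.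
Proof.
rewrite /zonal_terms !big_cons big_nil /mono /monomial /zonal /dot /=; ring.
Qed.

Lemma form_zonal y : form 4 (zonal y).
Proof. by exists (zonal_terms y); split=> // v; rewrite zonalE. Qed.

Lemma odd_fact_values : (odd_fact 0 = 1) * (odd_fact 2 = 1) * (odd_fact 4 = 3) *
  (odd_fact 6 = 15) * (odd_fact 8 = 105) * (odd_fact 10 = 945).
Proof.
by do !split; rewrite /odd_fact /= ?big_ord_recr big_ord0 //= -?natrM mul1r -?natrM.
Qed.

(** The reproducing property, as a polynomial identity in y for each of the 15 quartic monomials. *)
Lemma zonal_moment y a b c : (a + b + c)%N = 4%N ->
  \sum_(t <- zonal_terms y) t.1 * moment (t.2.1.1 + a) (t.2.1.2 + b) (t.2.2 + c)
  = 8 / 15 * monomial a b c y.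
Proof.
move=> abc; rewrite /zonal_terms !big_cons big_nil /=.
case: a abc => [|[|[|[|[|a]]]]]; case: b => [|[|[|[|[|b]]]]];
  case: c => [|[|[|[|[|c]]]]] //= abc; try lia.
all: by rewrite /moment /= !odd_fact_values /monomial /dot /= ?expr0 ?expr1; field.
Qed.

End forms.

(** * Lower bound: forms on at most 31 nodes *)

Lemma subset_between (T : finType) (A B : {set T}) n : A \subset B ->
  (#|A| <= n <= #|B|)%N ->
  exists Z : {set T}, [/\ A \subset Z, Z \subset B & #|Z| = n].
Proof.
elim/ltn_ind: {A}(n - #|A|)%N {-2}A (erefl (n - #|A|)%N) => m IH A mE AB /andP[An nB].
have [En|ltn] := eqVneq #|A| n; first by exists A.
have /properP[_ [i iB iA]] : A \proper B.
  by rewrite properEcard AB; apply: leq_trans nB; rewrite ltn_neqAle ltn.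
have [|||Z [AZ ZB Zn]] := IH (n - #|i |: A|)%N _ (i |: A) erefl.
- by rewrite -mE cardsU1 iA; move: ltn An; lia.
- by rewrite finset.subUset finset.sub1set iB.
- by rewrite nB cardsU1 iA andbT; move: ltn An; lia.
by exists Z; split=> //; apply: fintype.subset_trans AZ; exact: finset.subsetUr.
Qed.

Section lower_bound.
Context {R : realFieldType} (N : nat) (x : 'I_N -> seq R) (w : 'I_N -> R)
  (x1 : forall i, dot (x i) (x i) = 1) (w0 : forall i, 0 < w i)
  (cub_exact : forall a b c, (a + b + c <= 9)%N ->
     \sum_i w i * monomial a b c (x i) = moment a b c)
  (N31 : (N <= 31)%N).
Implicit Types (f g e : seq R -> R) (u v l y : seq R) (Y : {set 'I_N}).

Definition cub g : R := \sum_i w i * g (x i).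

Lemma cub_terms (s : seq (R * expt)) g h :
  (forall v, g v = \sum_(t <- s) t.1 * mono t.2 v) ->
  cub (fun v => g v * h v) = \sum_(t <- s) t.1 * cub (fun v => mono t.2 v * h v).
Proof.
move=> gE; rewrite /cub.
under eq_bigr => i _ do rewrite gE mulr_suml mulr_sumr.
rewrite exchange_big; apply: eq_bigr => t _ /=; rewrite mulr_sumr.
by apply: eq_bigr => i _; rewrite -mulrA mulrCA.
Qed.

Lemma cub_mono t : (tdeg t <= 9)%N -> cub (mono t) = moment t.1.1 t.1.2 t.2.
Proof. exact: cub_exact. Qed.

Lemma eq_cub f g : f =1 g -> cub f = cub g.
Proof. by move=> fg; apply: eq_bigr => i _; rewrite fg. Qed.

(** A monomial of odd degree has an odd exponent, so its moment is 0. The degrees of interest are 5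
    and 9. *)
Lemma cub_odd d g : form d g -> odd d -> (d <= 9)%N -> cub g = 0.
Proof.
move=> [s [sd gE]] od d9; transitivity (cub (fun v => g v * 1)).
  by apply: eq_cub => v; rewrite mulr1.
rewrite (cub_terms _ gE) big_seq big1// => t ts.
move/allP: sd => /(_ t ts) /eqP td.
rewrite (eq_cub (g := mono t.2)) => [|v]; last by rewrite mulr1.
rewrite cub_mono ?td// /moment; case: ifPn; rewrite ?mulr0//.
by move: od; rewrite -td /tdeg !oddD; do 3 case: (odd _).
Qed.

(** The product has degree 8, where the formula is exact, so the reproducing property carries over
    to [cub]. *)
Lemma cub_zonal y g : form 4 g -> cub (fun v => zonal y v * g v) = 8 / 15 * g y.
Proof.
move=> [s [sd gE]].
rewrite (eq_cub (g := fun v => g v * zonal y v)) => [|v]; last by rewrite mulrC.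
rewrite (cub_terms _ gE) gE mulr_sumr big_seq [RHS]big_seq; apply: eq_bigr => t ts.
move/allP: sd => /(_ t ts) /eqP t4.
rewrite mulrCA -(@zonal_moment _ y t.2.1.1 t.2.1.2 t.2.2)//; congr (_ * _).
rewrite (eq_cub (g := fun v => zonal y v * mono t.2 v)) => [|v]; last by rewrite mulrC.
rewrite (cub_terms _ (zonalE y)) big_seq [RHS]big_seq; apply: eq_bigr => r rz.
have r4 : tdeg r.2 = 4%N.
  have /allP : all (fun t => tdeg t.2 == 4%N) (zonal_terms y) by [].
  by move=> /(_ r rz) /eqP.
congr (_ * _); rewrite -(@cub_mono (tadd r.2 t.2)) ?tdegD ?r4 ?t4//.
by apply: eq_cub => v; rewrite monoM.
Qed.

(** By [cub_zonal], each value of g is a combination of its values at the nodes. *)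
Lemma form4_eq0 g : form 4 g -> (forall i, g (x i) = 0) -> forall v, g v = 0.
Proof.
move=> g4 gx v; have := cub_zonal v g4; rewrite /cub big1; last first.
  by move=> i _; rewrite gx !mulr0.
by move/esym/eqP; rewrite !mulf_eq0 invr_eq0 !pnatr_eq0 => /eqP.
Qed.

Lemma form4_orthogonal_eq0 g : form 4 g ->
  (forall q, form 4 q -> cub (fun v => g v * q v) = 0) -> forall v, g v = 0.
Proof.
move=> g4 gq v; have := gq _ (form_zonal v).
rewrite (eq_cub (g := fun u => zonal v u * g u)) => [|u]; last by rewrite mulrC.
by rewrite cub_zonal// => /eqP; rewrite !mulf_eq0 invr_eq0 !pnatr_eq0 => /eqP.
Qed.

(** A product of linear forms: for each j, the one with vector x_i0 - (x_j.x_i0) x_j, which is 0 at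
    x_j and 1 - (x_i0.x_j)^2 at x_i0. Copies of [dot (x i0)] fill up the degree. *)
Lemma separating_form n i0 (s : seq 'I_N) :
  (size s <= n)%N -> (forall j, j \in s -> dot (x i0) (x j) ^+ 2 != 1) ->
  exists k, [/\ form n k, k (x i0) != 0 & forall j, j \in s -> k (x j) = 0].
Proof.
elim: n s => [|n IH] s.
  rewrite leqn0 size_eq0 => /eqP -> _; exists (mono (0, 0, 0)%N); split => //.
  - exact: (form_mono (0, 0, 0)%N).
  - by rewrite /mono /monomial !expr0 !mulr1 oner_eq0.
case: s => [_ _|j s /=].
  have [//|//|k [kn k0 _]] := IH [::].
  exists (fun v => dot (x i0) v * k v); split => //.
    exact: (formM (form_dot _) kn).
  by rewrite x1 mul1r.
rewrite ltnS => sn js; have [//|h hs|k [kn k0 ks]] := IH s.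
  by apply: js; rewrite inE hs orbT.
pose l v := dot (x i0) v + - dot (x j) (x i0) * dot (x j) v.
exists (fun v => l v * k v); split.
- apply: (@formM _ 1 n) => //; apply: formD; first exact: form_dot.
  exact/formZ/form_dot.
- rewrite mulf_neq0// /l x1 dotC mulNr subr_eq0 eq_sym -expr2.
  by apply: js; rewrite inE eqxx.
- move=> h; rewrite inE => /orP[/eqP ->|hs]; last by rewrite ks// mulr0.
  by rewrite /l x1 dotC mulr1 subrr mul0r.
Qed.

Lemma card_exponents4 : size (exponents 4) = 15%N. Proof. by vm_compute. Qed.
Lemma card_exponents3 : size (exponents 3) = 10%N. Proof. by vm_compute. Qed.

Lemma comb4_eq0 (c : 'I_(size (exponents 4)) -> R) :
  (forall i, comb c (x i) = 0) -> forall k, c k = 0.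
Proof. by move=> c0; apply: comb_eq0; apply: form4_eq0 => //; exact: form_comb. Qed.

(** Turns a linear relation between functions on the nodes, as a dimension count yields it, into a
    relation between functionals of g. *)
Lemma cub_sum (J : finType) (c : J -> R) (S : J -> 'I_N) f g :
  (forall i, w i * f (x i) + \sum_j c j * (S j == i)%:R = 0) ->
  cub (fun v => f v * g v) + \sum_j c j * g (x (S j)) = 0.
Proof.
move=> H; transitivity (\sum_i (w i * f (x i) + \sum_j c j * (S j == i)%:R) * g (x i)).
  under [RHS]eq_bigr do rewrite mulrDl mulr_suml.
  rewrite big_split /= exchange_big /=; congr (_ + _).
    by apply: eq_bigr => i _; rewrite mulrA.
  apply: eq_bigr => j _; rewrite (bigD1 (S j))//= eqxx mulr1 big1 ?addr0// => i.
  by rewrite eq_sym => /negbTE ->; rewrite mulr0 mul0r.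
by rewrite big1// => i _; rewrite H mul0r.
Qed.

(** Otherwise the quartic form (l.v)^4 would vanish at all nodes, but not at l. *)
Lemma node_off_plane l : dot l l != 0 -> exists i, dot l (x i) != 0.
Proof.
move=> l0; apply/existsP; apply: contraNT l0; rewrite negb_exists => /forallP lx.
have l4 : form 4 (fun v => dot l v * dot l v * (dot l v * dot l v)).
  exact: (formM (formM (form_dot l) (form_dot l)) (formM (form_dot l) (form_dot l))).
have := form4_eq0 l4 _ l => /(_ _)/eqP; rewrite !mulf_eq0 !orbb; apply.
by move=> i; have := lx i; rewrite negbK => /eqP ->; rewrite !mul0r.
Qed.

(* On X the 15 quartic forms are orthogonal to the quintic ones, so that the 6
   evaluations at the S j, the evaluation at a node y off the plane and the 10
   functionals q |-> cub (f q), f cubic, are linearly dependent on quintic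
   forms q. Testing against multiples of l represents the evaluation of
   quartic forms at y by a multiple l f of l, which must then be zonal y; but
   zonal y does not vanish on the plane. *)
Lemma plane_nodes l (S : 'I_6 -> 'I_N) : dot l l != 0 ->
  (forall j, dot l (x (S j)) = 0) ->
  (forall j k, j != k -> dot (x (S j)) (x (S k)) ^+ 2 != 1) -> False.
Proof.
move=> l0 lS Spar; have [y ly] := node_off_plane l0.
pose E d k := mono (nth (0, 0, 0)%N (exponents d) k) : seq R -> R.
pose J := (('I_(size (exponents 4)) + 'I_(size (exponents 3))) + ('I_6 + unit))%type.
pose S' (j : 'I_6 + unit) := if j is inl j then S j else y.
pose u (j : J) i : R := match j with
  | inl (inl k) => w i * E 4%N k (x i) | inl (inr k) => w i * E 3%N k (x i)
  | inr j => (S' j == i)%:R end.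
(* 15 + 10 + 6 + 1 = 32 vectors in dimension N, at most 31. *)
have [|c [[j0 cj0] cu]] := @linear_dependence _ 'I_N J u.
  rewrite !card_sum card_unit !card_ord card_exponents4 card_exponents3; lia.
pose e := comb (fun k => c (inl (inl k))); pose f := comb (fun k => c (inl (inr k))).
pose a j := c (inr j).
have e4 : form 4 e by exact: form_comb.
have f3 : form 3 f by exact: form_comb.
have efa i : w i * (e (x i) + f (x i)) + \sum_j a j * (S' j == i)%:R = 0.
  rewrite -[RHS](cu i) !big_sumType /= mulrDr !mulr_sumr; congr (_ + _ + _).
    by apply: eq_bigr => k _; rewrite mulrCA.
  by apply: eq_bigr => k _; rewrite mulrCA.
(* The product e k has degree 9, so [cub] takes it to 0. *)
have pair k : form 5 k -> cub (fun v => f v * k v) + \sum_j a j * k (x (S' j)) = 0.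
  move=> k5; rewrite -[RHS](@cub_sum _ a S' (fun v => e v + f v) k efa); congr (_ + _).
  rewrite (eq_cub (f := fun v => (e v + f v) * k v)
    (g := fun v => e v * k v + f v * k v)) => [|v]; last by rewrite mulrDl.
  rewrite /cub [RHS](eq_bigr (fun i => w i * (e (x i) * k (x i))
    + w i * (f (x i) * k (x i)))).
    rewrite big_split /= -/(cub (fun v => e v * k v)).
    by rewrite (cub_odd (formM e4 k5))// add0r.
  by move=> i _; rewrite mulrDr.
(* The factor 15/8 cancels the constant of [cub_zonal]. *)
pose b := a (inr tt) * dot l (x y) * (15 / 8).
pose h v := dot l v * f v + b * zonal (x y) v.
have h4 : form 4 h.
  by apply: formD; [exact: (formM (form_dot l) f3)|exact/formZ/form_zonal].
have h0 : forall v, h v = 0.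
  apply: form4_orthogonal_eq0 => // q q4.
  have := pair _ (formM (form_dot l) q4).
  rewrite big_sumType /= (big_pred1 tt) => [|[]//].
  rewrite big1 ?add0r => [|j _]; last by rewrite lS mul0r mulr0.
  move=> <-; rewrite /cub.
  rewrite (eq_bigr (fun i => w i * (f (x i) * (dot l (x i) * q (x i)))
    + b * (w i * (zonal (x y) (x i) * q (x i))))) => [|i _]; last by rewrite /h; ring.
  rewrite big_split /= -mulr_sumr -/(cub (fun v => zonal (x y) v * q v)) cub_zonal//.
  by congr (_ + _); rewrite /b; field.
(* At a vector v orthogonal to l and to the node, h is b (v.v)^2. *)
have b0 : b = 0.
  have [v [v0 lv yv]] := orthogonal_vector l (x y).
  have /eqP := h0 v; rewrite /h lv mul0r add0r /zonal yv x1.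
  rewrite !expr0n /= !(mulr0, mul0r, oppr0, add0r, expr1n, mul1r).
  by rewrite mulf_eq0 expf_eq0 /= (negbTE v0) orbF => /eqP.
have f0 : forall v, f v = 0.
  by apply: (form_mul_dot_eq0 f3 l0) => v; rewrite -(h0 v) /h b0 mul0r addr0.
have ay : a (inr tt) = 0.
  move/eqP: b0; rewrite !mulf_eq0 (negbTE ly) invr_eq0 !pnatr_eq0 !orbF.
  by move/eqP.
(* Only evaluations at the six [S j] are left; a quintic form vanishing at five of them isolates the
   sixth. *)
have a0 j : a (inl j) = 0.
  pose s := [seq S k | k <- enum (predC1 j)].
  have [||k [k5 kj ks]] := @separating_form 5 (S j) s.
  - by rewrite size_map -cardE cardC1 card_ord.
  - by move=> _ /mapP[k + ->]; rewrite mem_enum !inE eq_sym => /Spar.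
  have := pair _ k5; rewrite /cub big1 ?add0r; last first.
    by move=> i _; rewrite f0 mul0r mulr0.
  rewrite big_sumType /= (big_pred1 tt) ?ay ?mul0r ?addr0 => [|[]//].
  rewrite (bigD1 j)//= big1 ?addr0.
    by move/eqP; rewrite mulf_eq0 (negbTE kj) orbF => /eqP.
  move=> i ij; rewrite ks ?mulr0//; apply/mapP; exists i => //.
  by rewrite mem_enum !inE.
have c3 k : c (inl (inr k)) = 0 by apply: (comb_eq0 f0).
have c4 k : c (inl (inl k)) = 0.
  apply: (@comb4_eq0 (fun k => c (inl (inl k)))) => i.
  have /eqP := efa i; rewrite big1 ?addr0; last first.
    by move=> [j|[]] _; rewrite ?a0 ?ay mul0r.
  by rewrite f0 addr0 mulf_eq0 gt_eqF//= => /eqP.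
move: cj0; case: j0 => [[k|k]|[j|[]]]; rewrite ?c3 ?c4 ?eqxx//.
- by rewrite -/(a _) a0 eqxx.
- by rewrite -/(a _) ay eqxx.
Qed.

(** The 3 functions a_j times a coordinate and the 15 quartic monomials are 18 functions on at most
    17 points, so some a l + e vanishes there. Testing the relation on the quintic form l e gives e
    = 0, so a is supported on the plane of l. *)
Lemma quintic_independent (J : finType) (S : J -> 'I_N) (a : J -> R) :
  (#|J| <= 17)%N ->
  (forall j k, j != k -> dot (x (S j)) (x (S k)) ^+ 2 != 1) ->
  (forall c : 'I_(size (exponents 4)) -> R,
     (forall j, comb c (x (S j)) = 0) -> forall k, c k = 0) ->
  (forall k, form 5 k -> \sum_j a j * k (x (S j)) = 0) ->
  forall j, a j = 0.
Proof.
move=> J17 Spar inj4 a5.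
pose u (k : 'I_3 + 'I_(size (exponents 4))) j := match k with
  | inl k => a j * (x (S j))`_k
  | inr k => mono (nth (0, 0, 0)%N (exponents 4) k) (x (S j)) end.
have [|c [[k0 ck0] cu]] :=
  @linear_dependence _ J ('I_3 + 'I_(size (exponents 4)))%type u.
  by rewrite card_sum !card_ord card_exponents4; move: J17; lia.
pose l := mkseq (fun k => c (inl (inord k))) 3.
have lE (k : 'I_3) : l`_k = c (inl k) by rewrite nth_mkseq// inord_val.
clearbody l; pose e := comb (fun k => c (inr k)).
have e4 : form 4 e by exact: form_comb.
have le j : a j * dot l (x (S j)) + e (x (S j)) = 0.
  rewrite -[RHS](cu j) big_sumType /=; congr (_ + _).
  by rewrite !big_ord_recl big_ord0 /dot -!lE /=; ring.
(* Substituting a l = - e leaves minus the sum of the squares of e. *)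
have e0 j : e (x (S j)) = 0.
  have := a5 _ (formM (form_dot l) e4).
  under eq_bigr => i _ do
    rewrite mulrA -[a i * _](addrK (e (x (S i)))) le sub0r mulNr -expr2 -mulN1r.
  move/eqP; rewrite -mulr_sumr mulf_eq0 oppr_eq0 oner_eq0 /=.
  rewrite psumr_eq0 => [/allP/(_ j)|i _]; last exact: sqr_ge0.
  by rewrite mem_index_enum => /(_ isT); rewrite sqrf_eq0 => /eqP.
have c0 k : c (inr k) = 0 by apply: (inj4 (fun k => c (inr k))).
have l0 : dot l l != 0.
  rewrite dot_eq0; apply: contra ck0 => /and3P[v0 v1 v2].
  case: k0 => k; last by rewrite c0.
  by rewrite -lE; case: k => -[|[|[|//]]] /=.
have al j : a j != 0 -> dot l (x (S j)) = 0.
  move=> aj; have /eqP := le j; rewrite e0 addr0 mulf_eq0 (negbTE aj).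
  by move=> /eqP.
have A5 : (#|[pred j | a j != 0%R]| <= 5)%N.
  rewrite leqNgt; apply/negP => A6.
  apply: (@plane_nodes l (fun j => S (enum_val (widen_ord A6 j)))) => // [j|j k jk].
    by apply: al; have := enum_valP (widen_ord A6 j).
  by apply: Spar; rewrite (inj_eq enum_val_inj); apply: contra jk => /eqP [/val_inj ->].
move=> j; apply/eqP/negPn/negP => aj.
(* A quintic form vanishing at the other points of the support isolates [a j]. *)
pose s := [seq S k | k in [pred k | a k != 0%R & k != j]].
have [||k [k5 kj ks]] := @separating_form 5 (S j) s.
- rewrite size_map -cardE; apply: leq_trans A5.
  apply/subset_leq_card/fintype.subsetP => k.
  by rewrite !inE => /andP[].
- move=> _ /mapP[k + ->]; rewrite mem_enum !inE => /andP[_ kj].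
  by apply: Spar; rewrite eq_sym.
have := a5 _ k5; rewrite (bigD1 j)//= big1 ?addr0.
  by move/eqP; rewrite mulf_eq0 (negbTE kj) orbF => /eqP/eqP; apply/negP.
move=> i ij; have [->|ai] := eqVneq (a i) 0; first by rewrite mul0r.
by rewrite ks ?mulr0//; apply/mapP; exists i => //; rewrite mem_enum !inE ai.
Qed.

(** * Lower bound: lines through the nodes and antipodality *)

Context (xI : forall i j, dot (x i) (x j) = 1 -> i = j).

(** |u + v|^2 = 1 + 1 - 2 = 0, so v is -u in each coordinate. *)
Lemma form_antipode d g u v : form d g -> dot u u = 1 -> dot v v = 1 -> dot u v = -1 ->
  g v = (-1) ^+ d * g u.
Proof.
move=> gd u1 v1 uv.
pose s := [:: u`_0 + v`_0; u`_1 + v`_1; u`_2 + v`_2].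
have : dot s s = 0.
  transitivity (dot u u + dot v v + dot u v *+ 2).
    by rewrite /s /dot /=; ring.
  by rewrite u1 v1 uv; ring.
move/eqP; rewrite dot_eq0 /= !addr_eq0 ![_ == - _]eq_sym !eqr_oppLR.
move=> /and3P[/eqP e0 /eqP e1 /eqP e2]; have [r [rd gE]] := gd.
rewrite !gE mulr_sumr big_seq [RHS]big_seq.
apply: eq_bigr => t tr; move/allP: rd => /(_ t tr) /eqP <-.
rewrite /mono /monomial /tdeg e0 e1 e2 -[- u`_0]mulN1r -[- u`_1]mulN1r -[- u`_2]mulN1r.
by rewrite !exprMn !exprD; ring.
Qed.

Definition antipodal i j := dot (x i) (x j) == -1.

Lemma antipodal_sym i j : antipodal i j = antipodal j i.
Proof. by rewrite /antipodal dotC. Qed.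

Lemma form_antipodal d g i j : form d g -> antipodal i j ->
  g (x j) = (-1) ^+ d * g (x i).
Proof. by move=> gd /eqP; exact: form_antipode. Qed.

Lemma antipodal_inj i j k : antipodal i j -> antipodal i k -> j = k.
Proof.
move=> ij ik; apply: xI; rewrite (form_antipodal (form_dot _) ik) dotC.
by rewrite (form_antipodal (form_dot _) ij) x1; ring.
Qed.

Lemma antipodal_irr i : ~~ antipodal i i.
Proof. by rewrite /antipodal x1; apply/negP => /eqP; lra. Qed.

Lemma parallel_nodes i j : dot (x i) (x j) ^+ 2 = 1 -> i != j -> antipodal i j.
Proof.
move/eqP; rewrite sqrf_eq1 => /orP[/eqP /xI ->|//]; by rewrite eqxx.
Qed.

(* One node on each line through the origin that contains nodes. *)
Definition reps : {set 'I_N} :=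
  [set i : 'I_N | [forall j : 'I_N, (j < i)%N ==> ~~ antipodal i j]].

Lemma reps_antipodal i j : i \in reps -> j \in reps -> ~~ antipodal i j.
Proof.
rewrite !inE => /forallP Ti /forallP Tj.
have [ij|ij|/val_inj ->] := ltngtP i j; last exact: antipodal_irr.
  by have := Tj i; rewrite ij antipodal_sym.
by have := Ti j; rewrite ij.
Qed.

Lemma reps_nonparallel i j : i \in reps -> j \in reps -> i != j ->
  dot (x i) (x j) ^+ 2 != 1.
Proof.
move=> Ti Tj ij; apply/eqP => /parallel_nodes /(_ ij).
by apply/negP; exact: reps_antipodal.
Qed.

Lemma reps_cover i : i \notin reps -> exists2 j, j \in reps & antipodal i j.
Proof.
rewrite inE negb_forall => /existsP[j]; rewrite negb_imply negbK => /andP[ji ij].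
exists j => //; rewrite inE; apply/forallP => k; apply/implyP => kj.
apply/negP => jk; have ki : i = k by apply: antipodal_inj jk; rewrite antipodal_sym.
by move: (ltn_trans kj ji); rewrite ki ltnn.
Qed.

(** Quartic forms are even: one that vanishes at a representative also vanishes at its antipode. *)
Lemma reps_unisolvent (c : 'I_(size (exponents 4)) -> R) :
  (forall i, i \in reps -> comb c (x i) = 0) -> forall k, c k = 0.
Proof.
move=> c0; apply: comb4_eq0 => i.
have [/c0//|/reps_cover[j Tj]] := boolP (i \in reps).
rewrite antipodal_sym => ji.
by rewrite (form_antipodal (form_comb c) ji) c0 ?mulr0.
Qed.

(** Among 17 or more representatives, 15 on which quartic forms are determined are completed to a
    set Z of 17. The quartic monomials, times w, and the indicator functions of Z are 32 vectors in
    R^N. A relation between them gives one on Z for quintic forms, which [quintic_independent] shows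
    to be trivial. *)
Lemma card_reps_le16 : (#|reps| <= 16)%N.
Proof.
rewrite leqNgt; apply/negP => T17.
pose n4 := size (exponents 4).
pose A := \matrix_(i < #|reps|, k < n4)
  mono (nth (0, 0, 0)%N (exponents 4) k) (x (enum_val i)).
have AE (c : 'I_n4 -> R) i : (A *m \col_k c k) i 0 = comb c (x (enum_val i)).
  by rewrite mxE; apply: eq_bigr => k _; rewrite !mxE mulrC.
have fA : row_full A.
  rewrite -[row_full A]/(\rank A == n4) -mxrank_tr -[_ == _]/(row_free A^T) -kermx_eq0.
  apply/rowV0P => v /sub_kermxP vA; apply/rowP => k; rewrite mxE.
  apply: (reps_unisolvent (c := v 0)) => i Ti.
  rewrite -[i](enum_rankK_in Ti) // -AE.
  have -> : \col_k v 0 k = v^T by apply/colP => h; rewrite !mxE.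
  by rewrite -[A]trmxK -trmx_mul vA !mxE.
(* The representatives of 15 rows of A that form an invertible matrix. *)
pose F k := enum_val (fullrankfun fA k).
have FI : injective F by move=> k h /enum_val_inj /fullrankfun_inj.
have [||Z [FZ ZT Z17]] := @subset_between _ [set F k | k : 'I_n4] reps 17.
- by apply/fintype.subsetP => _ /imsetP[k _ ->]; exact: enum_valP.
- by rewrite card_imset// card_ord [n4]card_exponents4 T17.
have cZ (c : 'I_n4 -> R) : (forall j : {j | j \in Z}, comb c (x (val j)) = 0) ->
    forall k, c k = 0.
  move=> c0; have : rowsub (fullrankfun fA) A *m \col_k c k = 0.
    apply/colP => k; rewrite mul_rowsub_mx mxE AE mxE.
    by apply: (c0 (Sub (F k) _)); apply: (fintype.subsetP FZ); exact: imset_f.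
  move/(congr1 (mulmx (invmx (rowsub (fullrankfun fA) A)))).
  rewrite mulmx0 mulKmx ?fullrowsub_unit// => /colP c00 k.
  by have := c00 k; rewrite !mxE.
pose J := ('I_n4 + {j | j \in Z})%type.
pose u (j : J) i := match j with
  | inl k => w i * mono (nth (0, 0, 0)%N (exponents 4) k) (x i)
  | inr j => (val j == i)%:R end.
have [|c [[j0 cj0] cu]] := @linear_dependence _ 'I_N J u.
  rewrite card_sum !card_ord card_sig [n4]card_exponents4.
  by rewrite -[#|[pred _ | _]|]/#|Z| Z17; exact: leq_ltn_trans N31 _.
pose e := comb (fun k => c (inl k)).
have e4 : form 4 e by exact: form_comb.
have ec i : w i * e (x i) + \sum_j c (inr j) * (val j == i)%:R = 0.
  rewrite -[RHS](cu i) big_sumType /= mulr_sumr; congr (_ + _).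
  by apply: eq_bigr => k _; rewrite mulrCA.
have cr : forall j, c (inr j) = 0.
  apply: (@quintic_independent _ val) => //.
  - by rewrite card_sig -[#|[pred _ | _]|]/#|Z| Z17.
  - move=> j k jk.
    by apply: reps_nonparallel => //; apply: (fintype.subsetP ZT); apply: valP.
  - move=> k k5; have := cub_sum k ec.
    by rewrite (cub_odd (formM e4 k5))// add0r.
have cl : forall k, c (inl k) = 0.
  apply: comb4_eq0 => i; have /eqP := ec i; rewrite big1 ?addr0; last first.
    by move=> j _; rewrite cr mul0r.
  by rewrite mulf_eq0 gt_eqF//= => /eqP.
by case: j0 cj0 => j; rewrite ?cr ?cl eqxx.
Qed.

(* On the representatives, the weights a i = w(i) - w(-i) annihilate the quintic
   forms, which are odd and of integral 0. *)
Lemma antipodal_weight i : exists2 j, antipodal i j & w j = w i.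
Proof.
wlog Ti : i / i \in reps.
  move=> H; have [/H//|/reps_cover[h Th ih]] := boolP (i \in reps).
  have [j hj wj] := H h Th; have <- : j = i.
    by apply: antipodal_inj hj _; rewrite antipodal_sym.
  by exists h => //; rewrite antipodal_sym.
(* The sum has at most one term; a missing antipode contributes 0. *)
pose a (j : {j | j \in reps}) :=
  w (val j) - \sum_(k | (k \notin reps) && antipodal (val j) k) w k.
have a0 : forall j, a j = 0.
  apply: (@quintic_independent _ val).
  - by rewrite card_sig; apply: leq_trans card_reps_le16 _.
  - by move=> j k jk; apply: reps_nonparallel; rewrite ?(valP j) ?(valP k).
  - move=> c c0; apply: reps_unisolvent => j Tj; exact: (c0 (Sub j Tj)).
  (* As k is odd, its sum over all nodes regroups into the sum of a_j k(x_j) over the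
     representatives. *)
  move=> k k5; rewrite -[RHS](cub_odd k5)// /cub (bigID (mem reps)) /=.
  rewrite [in RHS](eq_bigl (mem reps))//.
  rewrite (eq_bigr (fun j => w (val j) * k (x (val j)) +
    \sum_(h | (h \notin reps) && antipodal (val j) h) w h * k (x h))).
    rewrite big_split /=; congr (_ + _).
      by rewrite [RHS]big_sub.
    rewrite (exchange_big_dep (fun h => h \notin reps)) /=; last first.
      by move=> j h _ /andP[].
    apply: eq_bigr => h Th; have [j Tj hj] := reps_cover Th.
    rewrite (big_pred1 (Sub j Tj)) // => j'; rewrite Th /=.
    apply/idP/eqP => [j'h|->]; last by rewrite antipodal_sym.
    by apply/val_inj/(antipodal_inj (i := h)) => //; rewrite antipodal_sym.
  move=> j _; rewrite mulrBl mulr_suml -sumrN; congr (_ + _).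
  apply: eq_bigr => h /andP[_ jh]; rewrite (form_antipodal k5 jh); ring.
have := a0 (Sub i Ti); rewrite /a /= => /eqP; rewrite subr_eq0 => /eqP wi.
(* Without an antipode, [wi] would equate [w i] with an empty sum. *)
have [j /andP[Tj ij]|none] :=
  pickP (fun k => (k \notin reps) && antipodal i k); last first.
  by have := w0 i; rewrite wi big_pred0 ?ltxx.
exists j => //; rewrite wi (big_pred1 j) // => k.
apply/andP/eqP => [[_ ik]|->//]; exact: antipodal_inj ik ij.
Qed.

(** Antipodes exist, so [s] never takes its default; it maps the representatives injectively to
    other nodes, and twice their number is at most 31. *)
Lemma card_reps_le15 : (#|reps| <= 15)%N.
Proof.
pose s i := odflt i [pick j | antipodal i j].
have sP i : antipodal i (s i).
  rewrite /s; case: pickP => //= none; have [j ij _] := antipodal_weight i.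
  by rewrite none in ij.
have sI : injective s.
  move=> i j ij; apply: (antipodal_inj (i := s i)); rewrite antipodal_sym ?sP//.
  by rewrite ij sP.
have : (#|s @: reps| <= #|~: reps|)%N.
  apply/subset_leq_card/fintype.subsetP => _ /imsetP[i Ti ->]; rewrite inE.
  by apply/negP => Tsi; have := reps_antipodal Ti Tsi; rewrite sP.
rewrite card_imset//; have := N31; rewrite -[X in (X <= 31)%N]card_ord -(cardsC reps).
by move: #|reps| #|~: reps| => m n; lia.
Qed.

(** * Lower bound: weights and inner products of the nodes *)

Lemma cub_dot2 u : cub (fun v => dot u v ^+ 2) = dot u u / 3.
Proof.
pose s : seq (R * expt) := [:: (u`_0 ^+ 2, (2, 0, 0)%N); (u`_1 ^+ 2, (0, 2, 0)%N);
  (u`_2 ^+ 2, (0, 0, 2)%N); (2 * u`_0 * u`_1, (1, 1, 0)%N);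
  (2 * u`_0 * u`_2, (1, 0, 1)%N); (2 * u`_1 * u`_2, (0, 1, 1)%N)].
rewrite (eq_cub (g := fun v => dot u v ^+ 2 * 1)) => [|v]; last by rewrite mulr1.
rewrite (@cub_terms s) => [|v]; last first.
  by rewrite /s !big_cons big_nil /mono /monomial /dot /=; ring.
under eq_bigr => t _.
  rewrite (eq_cub (g := mono t.2)) => [|v]; last by rewrite mulr1.
  over.
by rewrite /s !big_cons big_nil !cub_mono// /moment /= !odd_fact_values /dot; field.
Qed.

Lemma cub1 : cub (fun=> 1) = 1.
Proof.
rewrite (eq_cub (g := mono (0, 0, 0)%N)) => [|v].
  by rewrite cub_mono// /moment /= !odd_fact_values; field.
by rewrite /mono /monomial !expr0 !mulr1.
Qed.

Lemma zonal_self u : dot u u = 1 -> zonal u u = 8.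
Proof. by move=> u1; rewrite /zonal u1; ring. Qed.

(* With at most 15 representatives, some quartic form vanishes at all of them
   but one; integrate its products with the zonal forms. *)
Lemma zonal_reps i0 : i0 \in reps ->
  w i0 = 30^-1 /\ forall i, i \in reps -> i != i0 -> zonal (x i) (x i0) = 0.
Proof.
move=> T0; have [j0 i0j0 wj0] := antipodal_weight i0.
pose J := ('I_(size (exponents 4)) + unit)%type.
pose u (j : J) (i : {i | i \in reps}) : R := match j with
  | inl k => mono (nth (0, 0, 0)%N (exponents 4) k) (x (val i))
  | inr _ => (val i == i0)%:R end.
(* The quartic monomials and the indicator function of i0 are 16 vectors in dimension at most 15. *)
have [|c [[j1 cj1] cu]] := @linear_dependence _ {i | i \in reps} J u.
  rewrite card_sum card_unit !card_ord card_sig card_exponents4.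
  by rewrite -[#|[pred _ | _]|]/#|reps| ltnS; exact: card_reps_le15.
pose e := comb (fun k => c (inl k)).
have e4 : form 4 e by exact: form_comb.
have eT i : i \in reps -> e (x i) = - c (inr tt) * (i == i0)%:R.
  move=> Ti; have := cu (Sub i Ti); rewrite big_sumType /= (big_pred1 tt) => [|[]//].
  by move/eqP; rewrite addr_eq0 -mulNr => /eqP.
have ee0 : e (x i0) != 0.
  apply: contra cj1; rewrite eT// eqxx mulr1 oppr_eq0 => /eqP c0.
  case: j1 => [k|[]]; last by rewrite c0.
  apply/eqP; apply: (reps_unisolvent (c := fun k => c (inl k))) => i Ti.
  by rewrite -/(e _) eT// c0 oppr0 mul0r.
have ex i : i != i0 -> i != j0 -> e (x i) = 0.
  move=> ii0 ij0; have [Ti|/reps_cover[h Th ih]] := boolP (i \in reps).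
    by rewrite eT// (negbTE ii0) mulr0.
  have hi0 : h != i0.
    apply: contra ij0 => /eqP hi; apply/eqP/(antipodal_inj (i := i0)) => //.
    by rewrite antipodal_sym -hi.
  rewrite antipodal_sym in ih.
  by rewrite (form_antipodal e4 ih) eT// (negbTE hi0) !mulr0.
have ji : j0 != i0 by apply: contraL i0j0 => /eqP ->; exact: antipodal_irr.
(* Among the nodes, e is nonzero only at i0 and its antipode, which contribute equally to the
   reproducing formula. *)
have key i : 8 / 15 * e (x i) = 2 * w i0 * zonal (x i) (x i0) * e (x i0).
  rewrite -cub_zonal// /cub (bigD1 i0)//= (bigD1 j0)//= big1 ?addr0; last first.
    by move=> k /andP[ki kj]; rewrite ex ?mulr0.
  rewrite (form_antipodal e4 i0j0) (form_antipodal (form_zonal _) i0j0) wj0; ring.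
(* For i = i0 the factor [e (x i0)] cancels, leaving 8/15 = 16 w(i0). *)
have wi0 : w i0 = 30^-1.
  have := key i0; rewrite zonal_self// => /(mulIf ee0) H; lra.
split=> // i Ti ii0; have /eqP := key i; rewrite eT// (negbTE ii0) !mulr0 eq_sym.
rewrite !mulf_eq0 (negbTE ee0) orbF pnatr_eq0 /= (gt_eqF (w0 i0)) /=.
by move/eqP.
Qed.

Lemma int_combination (I : finType) (P : pred I) (v : I -> R) (q : R) :
  (forall i, P i -> v i ^+ 2 = q ^+ 2) ->
  exists m : int, \sum_(i | P i) v i = m%:~R * q.
Proof.
move=> vq; elim/big_rec: _ => [|i s Pi [m ->]]; first by exists 0; rewrite mul0r.
have /eqP := vq i Pi; rewrite eqf_sqr => /orP[/eqP ->|/eqP ->].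
  by exists (1 + m); rewrite rmorphD mulrDl mul1r.
by exists (-1 + m); rewrite rmorphD rmorphN1 mulrDl mulN1r.
Qed.

(** Off x_i0 and its antipode, the numbers v_i = 3 (x_i0.x_i)^2 - 1 have sum -4 and squares 4/7. So
    -4 is m times one of them for an integer m, and m^2 = 28. *)
Lemma cubature_contradiction : False.
Proof.
have [i0 T0] : exists i0, i0 \in reps.
  have [i Ti|no] := pickP (mem reps); first by exists i.
  have := oner_neq0 R; rewrite -cub1 /cub big1 ?eqxx// => i _.
  have /reps_cover[j Tj _] : i \notin reps by rewrite [i \in _]no.
  by rewrite [j \in _]no in Tj.
have w30 i : w i = 30^-1.
  have [Ti|/reps_cover[j Tj ij]] := boolP (i \in reps).
    by have [] := zonal_reps Ti.
  have [k ik <-] := antipodal_weight i.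
  by rewrite (antipodal_inj ik ij); have [] := zonal_reps Tj.
have [j0 ij0 _] := antipodal_weight i0.
have j0i0 : j0 != i0 by apply: contraL ij0 => /eqP ->; exact: antipodal_irr.
pose v i := 3 * dot (x i0) (x i) ^+ 2 - 1.
pose P := [pred i | (i != i0) && (i != j0)].
(* v is twice the Legendre polynomial P_2, of integral 0, and the weights are equal. *)
have sum_v : \sum_i v i = 0.
  have : cub (fun u => 3 * dot (x i0) u ^+ 2 - 1) = 0.
    transitivity (3 * cub (fun u => dot (x i0) u ^+ 2) - cub (fun=> 1)).
      rewrite /cub mulr_sumr -sumrB; apply: eq_bigr => i _; ring.
    by rewrite cub_dot2 cub1 x1; field.
  rewrite /cub; under eq_bigr do rewrite w30.
  by rewrite -mulr_sumr => /eqP; rewrite mulf_eq0 invr_eq0 pnatr_eq0 => /eqP.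
have sum_P : \sum_(i | P i) v i = -4.
  have vi0 : v i0 = 2 by rewrite /v x1; ring.
  have vj0 : v j0 = 2 by rewrite /v (form_antipodal (form_dot _) ij0) x1; ring.
  move: sum_v; rewrite (bigD1 i0)//= (bigD1 j0)//= vi0 vj0.
  set S := (X in 2 + (2 + X)) => H; rewrite -[LHS]/S; lra.
(* With s = x_i0.x_i, the zonal form vanishes: 21 s^4 - 14 s^2 + 1 = 0, i.e., (3 s^2 - 1)^2 =
   4/7. *)
have vP i : P i -> v i ^+ 2 = 4 / 7.
  move=> /andP[ii0 iij0].
  have [h Th hE] : exists2 h, h \in reps &
      (h != i0) && (dot (x i0) (x h) ^+ 2 == dot (x i0) (x i) ^+ 2).
    have [Ti|/reps_cover[h Th ih]] := boolP (i \in reps).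
      by exists i; rewrite // ii0 eqxx.
    exists h => //; rewrite (form_antipodal (form_dot _) ih).
    rewrite exprMn sqrr_sign mul1r eqxx andbT.
    apply: contra iij0 => /eqP hi; apply/eqP/(antipodal_inj (i := i0)) => //.
    by rewrite antipodal_sym -hi.
  move: hE => /andP[hi0 /eqP hE].
  have [_ /(_ h Th hi0)] := zonal_reps T0.
  rewrite /zonal !x1 [dot (x h) _]dotC (_ : 4 = 2 * 2)%N// exprM hE /v => z.
  have -> : (3 * dot (x i0) (x i) ^+ 2 - 1) ^+ 2 =
      3 / 7 * (21 * (dot (x i0) (x i) ^+ 2) ^+ 2
        - 14 * dot (x i0) (x i) ^+ 2 * 1 * 1 + 1 ^+ 2 * 1 ^+ 2) + 4 / 7 by field.
  by rewrite z mulr0 add0r.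
have [i1 Pi1|P0] := pickP P; last first.
  move/eqP: sum_P; rewrite big_pred0// eq_sym oppr_eq0 pnatr_eq0 //.
have [m mE] : exists m : int, \sum_(i | P i) v i = m%:~R * v i1.
  by apply: int_combination => i Pi; rewrite !vP.
have : (m ^+ 2)%:~R = 28%:~R :> R.
  have := congr1 (fun z => z ^+ 2) mE; rewrite sum_P exprMn vP// rmorphXn /= => H.
  by rewrite -[_ ^+ 2](mulfK (_ : 4 / 7 != 0 :> R)) -?H; [field|lra].
move=> /intr_inj m28.
have : `|m| ^+ 2 = 28 by rewrite real_normK ?num_real.
move: `|m| (normr_ge0 m) => k k0 k28.
(* 28 lies strictly between 5^2 and 6^2. *)
have [k5|k6] : k <= 5 \/ 6 <= k by lia.
- by nia.
- by nia.
Qed.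

End lower_bound.

(** * The formula with 32 nodes *)

Lemma sum_pair (V : nmodType) (I J : finType) (F : I * J -> V) :
  \sum_p F p = \sum_i \sum_j F (i, j).
Proof. by rewrite pair_bigA; apply: eq_bigr => -[]. Qed.

Section thirty_two.
Context {R : rcfType}.
Implicit Types (s : bool) (u v : R).

Definition sgb s u : R := if s then u else - u.

Lemma sgb_inj s s' u v : 0 < u -> 0 < v -> sgb s u = sgb s' v -> s = s' /\ u = v.
Proof. by move=> u0 v0; case: s; case: s' => /= uv; split => //; lra. Qed.

Lemma sgb_neq0 s u : 0 < u -> (sgb s u == 0) = false.
Proof. by move=> u0; apply/negbTE; rewrite /sgb; case: s; rewrite ?oppr_eq0 gt_eqF. Qed.

(** Power sums over signs involve only u^2, which frees the coordinates of their outer square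
    roots. *)
Lemma sum_sgb u n : \sum_s sgb s u ^+ n = if odd n then 0 else 2 * (u ^+ 2) ^+ n./2.
Proof.
rewrite big_bool /= exprNn -exprM mul2n; case: ifP => on.
  by rewrite -signr_odd on expr1 mulN1r subrr.
by rewrite -signr_odd on mul1r halfK on subn0; ring.
Qed.

Definition s5 : R := Num.sqrt 5.

Lemma s5_sqr : s5 ^+ 2 = 5. Proof. by rewrite sqr_sqrtr. Qed.

Lemma s5_bounds : 2 < s5 /\ s5 < 3.
Proof.
have s0 : 0 <= s5 by exact: sqrtr_ge0.
by have := s5_sqr; split; nra.
Qed.

(* The nodes are the vertices of a regular icosahedron ([true]) and of its dual
   dodecahedron ([false] and the cube); rotating (0, u, v) gives the vertices on
   the coordinate planes. *)
Definition coord (t : bool) : R * R :=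
  if t then (Num.sqrt ((5 - s5) / 10), Num.sqrt ((5 + s5) / 10))
  else (Num.sqrt ((3 + s5) / 6), Num.sqrt ((3 - s5) / 6)).

(** 12 vertices of each solid lie on coordinate planes; the other 8 of the dodecahedron form the
    cube. *)
Definition node_index := ((bool * 'I_3 * bool * bool) + (bool * bool * bool))%type.

Definition node (i : node_index) : 3.-tuple R :=
  match i with
  | inl (t, k, s, s') =>
    let u := sgb s (coord t).1 in let v := sgb s' (coord t).2 in
    match val k with
    | 0%N => [tuple 0; u; v] | 1%N => [tuple v; 0; u] | _ => [tuple u; v; 0]
    end
  | inr (s0, s1, s2) => [tuple sgb s0 (Num.sqrt 3^-1); sgb s1 (Num.sqrt 3^-1);
      sgb s2 (Num.sqrt 3^-1)]
  end.

Definition weight (i : node_index) : R :=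
  if i is inl (true, _, _, _) then 5 / 168 else 9 / 280.

Lemma weight_gt0 i : 0 < weight i.
Proof. by case: i => [[[[[] ?] ?] ?]|?] /=; lra. Qed.

Lemma coord_sqr t : (coord t).1 ^+ 2 = (if t then (5 - s5) / 10 else (3 + s5) / 6) /\
  (coord t).2 ^+ 2 = (if t then (5 + s5) / 10 else (3 - s5) / 6).
Proof. by have [? ?] := s5_bounds; case: t => /=; split; rewrite sqr_sqrtr//; lra. Qed.

Lemma coord_gt0 t : 0 < (coord t).1 /\ 0 < (coord t).2.
Proof. by have [? ?] := s5_bounds; case: t => /=; split; rewrite sqrtr_gt0; lra. Qed.

Lemma coord_inj t t' : (coord t).1 = (coord t').1 -> t = t'.
Proof.
have [? ?] := s5_bounds.
move=> /(congr1 (fun z => z ^+ 2)); rewrite !(coord_sqr _).1.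
by case: t; case: t' => // ?; exfalso; lra.
Qed.

Lemma cube_coord_sqr : Num.sqrt 3^-1 ^+ 2 = 3^-1 :> R.
Proof. by rewrite sqr_sqrtr// invr_ge0. Qed.

Lemma cube_coord_gt0 : 0 < Num.sqrt 3^-1 :> R.
Proof. by rewrite sqrtr_gt0 invr_gt0. Qed.

(** The zero coordinate, if there is one, gives the plane; the size of the entries gives the solid,
    and their signs the rest. *)
Lemma node_inj : injective node.
Proof.
have e0 := cube_coord_gt0.
move=> [[[[t [k kP]] s] s']|[[s0 s1] s2]];
  move=> [[[[t' [k' kP']] z] z']|[[z0 z1] z2]] /=; last first.
- by case=> /(sgb_inj e0 e0)[-> _] /(sgb_inj e0 e0)[-> _] /(sgb_inj e0 e0)[-> _].
- case: k' kP' => [|[|[|//]]] kP' /= [] => [/eqP|_ /eqP|_ _ /eqP];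
    by rewrite sgb_neq0.
- case: k kP => [|[|[|//]]] kP /= [] => [/esym/eqP|_ /esym/eqP|_ _ /esym/eqP];
    by rewrite sgb_neq0.
have [u0 v0] := coord_gt0 t; have [u0' v0'] := coord_gt0 t'.
have fin : sgb s (coord t).1 = sgb z (coord t').1 ->
    sgb s' (coord t).2 = sgb z' (coord t').2 -> [/\ t = t', s = z & s' = z'].
  by move=> /(sgb_inj u0 u0')[sz /coord_inj tt'] /(sgb_inj v0 v0')[sz' _].
have no0 : 0 <> sgb s (coord t).1 by move/esym/eqP; rewrite sgb_neq0.
have no1 : 0 <> sgb s' (coord t).2 by move/esym/eqP; rewrite sgb_neq0.
have no2 : 0 <> sgb z (coord t').1 by move/esym/eqP; rewrite sgb_neq0.
have no3 : 0 <> sgb z' (coord t').2 by move/esym/eqP; rewrite sgb_neq0.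
case: k kP => [|[|[|//]]] kP; case: k' kP' => [|[|[|//]]] kP' /= [].
all: move=> *; try by exfalso; congruence.
all: have [-> -> ->] : [/\ t = t', s = z & s' = z'] by apply: fin; congruence.
all: by congr (inl (_, _, _, _)); apply: val_inj.
Qed.

Lemma node_sphere i : dot (node i) (node i) = 1.
Proof.
have sg2 s u : sgb s u * sgb s u = u ^+ 2 by case: s; rewrite /sgb -?expr2 ?sqrrN.
case: i => [[[[t [k kP]] s] s']|[[s0 s1] s2]].
  case: k kP => [|[|[|//]]] kP; rewrite /dot /= !sg2 (coord_sqr t).1 (coord_sqr t).2;
    by case: t; field.
by rewrite /dot /= !sg2 cube_coord_sqr; field.
Qed.

Lemma node_cubature a b c : (a + b + c <= 9)%N ->
  \sum_i weight i * monomial a b c (node i) = moment a b c.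
Proof.
move=> abc.
pose P u n : R := \sum_s sgb s u ^+ n.
(* Sums over signs of products of powers are products of power sums. *)
have -> : \sum_i weight i * monomial a b c (node i) =
  \sum_(t : bool) weight (inl (t, ord0, true, true)) *
    (0 ^+ a * P (coord t).1 b * P (coord t).2 c
     + P (coord t).2 a * 0 ^+ b * P (coord t).1 c
     + P (coord t).1 a * P (coord t).2 b * 0 ^+ c)
  + 9 / 280 * (P (Num.sqrt 3^-1) a * P (Num.sqrt 3^-1) b * P (Num.sqrt 3^-1) c).
  rewrite big_sumType !sum_pair /= !big_bool; congr (_ + _).
    congr (_ + _); rewrite !big_ord_recl !big_ord0 !big_bool;
      by rewrite /P /monomial /= ?big_bool /=; ring.
  by rewrite ?sum_pair ?big_bool /P /monomial /= ?big_bool /=; ring.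
rewrite [X in X + _]big_bool /P !sum_sgb !(coord_sqr _).1 !(coord_sqr _).2.
rewrite cube_coord_sqr /=.
have := s5_sqr; move: s5 => s s2.
(* The powers of s that occur, up to the fourth, become linear in s, within reach of [lra]. *)
have s3 : s ^+ 3 = 5 * s by rewrite exprS s2 mulrC.
have s4 : s ^+ 4 = 25 by rewrite (exprM s 2 2) s2; ring.
rewrite /moment /monomial.
(* For an odd exponent, each summand has a factor 0: a power of 0 or a power sum over signs. *)
have [oa|ea] := boolP (odd a).
  by rewrite (expr0n _ a); case: a oa {abc} => //= a _; ring.
have [ob|eb] := boolP (odd b).
  by rewrite (expr0n _ b); case: b ob {abc} => //= b _; ring.
have [oc|ec] := boolP (odd c).
  by rewrite (expr0n _ c); case: c oc {abc} => //= c _; ring.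
have [i ai] : exists i, a = i.*2 by exists a./2; rewrite halfK (negbTE ea) subn0.
have [j bj] : exists j, b = j.*2 by exists b./2; rewrite halfK (negbTE eb) subn0.
have [k ck] : exists k, c = k.*2 by exists c./2; rewrite halfK (negbTE ec) subn0.
subst a b c; clear ea eb ec.
have {abc} ijk : (i + j + k <= 4)%N by lia.
rewrite !doubleK.
case: i ijk => [|[|[|[|[|i]]]]]; case: j => [|[|[|[|[|j]]]]];
  case: k => [|[|[|[|[|k]]]]] //= ijk; try by exfalso; lia.
all: rewrite !odd_fact_values ?expr0n /=; lra.
Qed.

End thirty_two.

Local Open Scope classical_set_scope.

(** * Integrals of powers of sine and cosine *)

Section trig.
Context {R : realType}.
Notation mu := (@lebesgue_measure R).
Implicit Types (B : R) (p q : nat) (F f : R -> R).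

Lemma continuous_Rintegrable f (a b : R) :
  continuous f -> mu.-integrable `[a, b] (EFin \o f).
Proof.
move=> cf; apply: continuous_compact_integrable; first exact: segment_compact.
exact: continuous_subspaceT.
Qed.

Lemma Rintegral_derive F f B : 0 < B -> continuous f ->
  (forall x, is_derive x (1 : R) F (f x)) ->
  \int[mu]_(x in `[0, B]) f x = F B - F 0.
Proof.
move=> B0 cf dF.
have cF : continuous F.
  move=> x; apply: differentiable_continuous; apply/derivable1_diffP.
  by have [] := dF x.
rewrite /Rintegral (@continuous_FTC2 _ _ F) //.
- exact: continuous_subspaceT.
- split => [x _||]; first by have [] := dF x.
    exact/cvg_at_right_filter/cF.
  exact/cvg_at_left_filter/cF.
- by move=> x _; rewrite derive1E; have [_ ->] := dF x.
Qed.

Definition trig p q (x : R) : R := sin x ^+ p * cos x ^+ q.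

Lemma continuous_trig p q : continuous (trig p q).
Proof.
move=> x; apply: (@continuousM _ _ (fun x => sin x ^+ p) (fun x => cos x ^+ q)).
  apply: (@continuous_comp _ _ _ sin (fun y => y ^+ p)).
    exact: continuous_sin.
  exact: exprn_continuous.
apply: (@continuous_comp _ _ _ cos (fun y => y ^+ q)).
  exact: continuous_cos.
exact: exprn_continuous.
Qed.

(** [B] will be pi for the polar angle and 2 pi for the azimuth, both zeros of the sine. *)
Definition trigint B p q : R := \int[mu]_(x in `[0, B]) trig p q x.

Lemma continuous_trigZ (a : R) p q : continuous (fun x : R => a * trig p q x).
Proof.
move=> x; apply: (@continuousM _ _ (cst a)); first exact: cst_continuous.
exact: continuous_trig.
Qed.

Lemma trigintD B p q :
  trigint B p.+2 q + trigint B p q.+2 = trigint B p q.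
Proof.
rewrite /trigint -RintegralD//; try exact: continuous_Rintegrable (@continuous_trig _ _).
apply: eq_Rintegral => x _; rewrite /trig -[RHS]mulr1 -(cos2Dsin2 x).
by rewrite !exprS; ring.
Qed.

(** Where a predecessor is truncated at 0, its coefficient is 0. *)
Lemma is_derive_trig p q (x : R) :
  is_derive x (1 : R) (trig p q)
   (p%:R * trig p.-1 q.+1 x - q%:R * trig p.+1 q.-1 x).
Proof.
have -> : trig p q = (sin ^+ p) * (cos ^+ q) :> (R -> R).
  by apply/funext => y; rewrite /trig !fctE.
apply: is_derive_eq; rewrite /GRing.scale /= !fctE /trig.
by case: p => [|p]; case: q => [|q] /=; rewrite ?exprS; ring.
Qed.

(** The function sin^(p+1) cos^(q+1) vanishes at 0 and B, so its derivative has integral 0. *)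
Lemma trigint_boundary B p q : 0 < B -> sin B = 0 ->
  p.+1%:R * trigint B p q.+2 = q.+1%:R * trigint B p.+2 q.
Proof.
move=> B0 sB0; apply/eqP; rewrite -subr_eq0; apply/eqP.
rewrite /trigint -!RintegralZl//; try exact: continuous_Rintegrable (@continuous_trig _ _).
rewrite -RintegralB//; try exact/continuous_Rintegrable/continuous_trigZ.
rewrite (Rintegral_derive B0 _ (is_derive_trig p.+1 q.+1)) /=; last first.
  move=> x.
  exact: cvgB (@continuous_trigZ p.+1%:R p q.+2 x)
    (@continuous_trigZ q.+1%:R p.+2 q x).
by rewrite /trig sin0 sB0 !expr0n !mul0r subrr.
Qed.

Lemma trigint_cos B p q : 0 < B -> sin B = 0 ->
  trigint B p q.+2 = q.+1%:R / (p + q + 2)%:R * trigint B p q.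
Proof.
move=> B0 sB0; have := trigint_boundary p q B0 sB0.
have := trigintD B p q => <- E.
have n0 : (p + q + 2)%:R != 0 :> R by rewrite pnatr_eq0 addn2.
apply: (mulfI n0); rewrite mulrA [_%:R * (_ / _)]mulrC mulfVK// mulrDr -E !natrD; ring.
Qed.

Lemma trigint_sin B p q : 0 < B -> sin B = 0 ->
  trigint B p.+2 q = p.+1%:R / (p + q + 2)%:R * trigint B p q.
Proof.
move=> B0 sB0; have := trigint_boundary p q B0 sB0.
have := trigintD B p q => <- E.
have n0 : (p + q + 2)%:R != 0 :> R by rewrite pnatr_eq0 addn2.
apply: (mulfI n0); rewrite mulrA [_%:R * (_ / _)]mulrC mulfVK// mulrDr E !natrD; ring.
Qed.

(** The recursion leads down to q = 1, with antiderivative sin^(p+1) / (p+1). *)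
Lemma trigint_cos_odd B p q : 0 < B -> sin B = 0 -> odd q ->
  trigint B p q = 0.
Proof.
move=> B0 sB0; elim/ltn_ind: q => -[|[|q]] //= IH oq; last first.
  by rewrite trigint_cos// IH ?mulr0//; move: oq; rewrite negbK.
have d (x : R) : is_derive x (1 : R)
    (fun x => p.+1%:R^-1 * trig p.+1 0 x) (trig p 1 x).
  have := is_derive_trig p.+1 0 x; rewrite mul0r subr0 /= => d.
  by apply: is_derive_eq; rewrite /GRing.scale /= mulKf// pnatr_eq0.
rewrite /trigint (Rintegral_derive B0 (@continuous_trig p 1) d).
by rewrite /trig sin0 sB0 !expr0n !mul0r mulr0 subrr.
Qed.

Lemma trigint10 : trigint pi 1 0 = 2.
Proof.
have d (x : R) : is_derive x (1 : R) (fun x => - trig 0 1 x) (trig 1 0 x).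
  have := is_derive_trig 0 1 x; rewrite mul0r sub0r mul1r /= => d.
  by apply: is_derive_eq; rewrite opprK.
rewrite /trigint (Rintegral_derive (pi_gt0 R) (@continuous_trig 1 0) d).
by rewrite /trig sin0 cos0 cospi expr0 expr1; ring.
Qed.

Lemma trigint_2pi_00 : trigint (2 * pi) 0 0 = 2 * pi.
Proof.
have d (x : R) : is_derive x (1 : R) id (trig 0 0 x).
  by rewrite /trig !expr0 mulr1; exact: is_derive_id.
rewrite /trigint (Rintegral_derive _ (@continuous_trig 0 0) d) ?subr0//.
by rewrite mulr_gt0 ?pi_gt0.
Qed.

Lemma sin2pi : sin (2 * pi) = 0 :> R.
Proof. by rewrite mulr_natl sin_mulr2n sinpi mulr0 mul0rn. Qed.

Lemma cos2pi : cos (2 * pi) = 1 :> R.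
Proof. by rewrite mulr_natl cos_mulr2n cospi sqrrN expr1n mulr2n addrK. Qed.

(** The recursion leads down to p = 1, with antiderivative - cos^(q+1) / (q+1), of period 2 pi. *)
Lemma trigint_2pi_sin_odd p q : odd p -> trigint (2 * pi) p q = 0.
Proof.
have B0 : 0 < 2 * pi :> R by rewrite mulr_gt0 ?pi_gt0.
have sB0 := sin2pi.
elim/ltn_ind: p => -[|[|p]] //= IH op; last first.
  by rewrite trigint_sin// IH ?mulr0//; move: op; rewrite negbK.
have d (x : R) : is_derive x (1 : R)
    (fun x => - (q.+1%:R^-1 * trig 0 q.+1 x)) (trig 1 q x).
  have := is_derive_trig 0 q.+1 x; rewrite mul0r sub0r /= => d.
  by apply: is_derive_eq; rewrite /GRing.scale /= mulrN opprK mulKf// pnatr_eq0.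
rewrite /trigint (Rintegral_derive B0 (@continuous_trig 1 q) d).
by rewrite /trig sin0 cos0 sin2pi cos2pi !expr1n expr0 subrr.
Qed.

(** In x^a y^b the azimuth enters as cos^a sin^b, and [trigint] takes the exponent of the sine
    first. *)
Lemma trigint_azimuth b a : ~~ odd a -> ~~ odd b ->
  trigint (2 * pi) b a = 2 * pi * (odd_fact a * odd_fact b / even_fact (a + b)).
Proof.
have B0 : 0 < 2 * pi :> R by rewrite mulr_gt0 ?pi_gt0.
have sB0 := sin2pi.
elim/ltn_ind: a b => -[|[|a]] IHa b ea eb //.
  elim/ltn_ind: b eb => -[|[|b]] IHb eb //.
    rewrite trigint_2pi_00 /odd_fact /even_fact /= !big_ord0.
    by rewrite !(mulr1, mul1r, divr1).
  rewrite /= negbK in eb.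
  rewrite trigint_sin// IHb// !add0n odd_factS even_factS halfK (negbTE eb) subn0.
  have := even_fact_neq0 b; rewrite addn0 addn2 invfM => ?.
  ring.
rewrite /= negbK in ea.
rewrite trigint_cos// IHa// !addSn odd_factS even_factS !halfK oddD.
rewrite (negbTE ea) (negbTE eb) !subn0 addn2 [(b + a)%N]addnC invfM.
ring.
Qed.

(** k will be a + b; the additional sine comes from the area element. *)
Lemma trigint_polar k c : ~~ odd k -> ~~ odd c ->
  trigint pi k.+1 c = 2 * (even_fact k * odd_fact c / odd_fact (k + c).+2).
Proof.
have B0 := pi_gt0 R; have sB0 := @sinpi R.
elim/ltn_ind: k c => -[|[|k]] IHk c ek ec //.
  elim/ltn_ind: c ec => -[|[|c]] IHc ec //.
    rewrite trigint10 add0n /odd_fact /even_fact /= big_ord_recr !big_ord0 /=.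
    by rewrite !(mulr1, mul1r, divr1).
  rewrite /= negbK in ec.
  rewrite trigint_cos// IHc// !add0n [odd_fact c.+4]odd_factS !odd_factS.
  rewrite -[c.+2./2.*2]/(c./2.*2.+2) halfK (negbTE ec) subn0 add1n addn2.
  rewrite !invfM; field.
  by rewrite -natrD nat1r !pnatr_eq0 odd_fact_neq0.
rewrite /= negbK in ek.
rewrite trigint_sin// IHk// !addSn [odd_fact (k + c).+4]odd_factS even_factS.
rewrite -[(k + c).+2./2.*2]/((k + c)./2.*2.+2) !halfK oddD (negbTE ek) (negbTE ec).
rewrite !subn0 addn2 invfM; ring.
Qed.

End trig.

(** * Integration over the sphere in angles *)

Section sphere_integral.
Context {R : realType}.
Local Open Scope ereal_scope.
Notation mu := (@lebesgue_measure R).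
Notation mu2 := (mu \x mu)%E.
Notation sph := (@sphere_measure R).

Import HBNNSimple.

(** On each level set, this is the definition of [sphere_measure]. *)
Lemma nnsfun_integral_sphere (g : {nnsfun (3.-tuple R) >-> R}) :
  \int[sph]_y (g y)%:E = \int[mu2]_p ((g (spherical p))%:E * (area_density p)%:E).
Proof.
have mpre (A : set (3.-tuple R)) : measurable A ->
    measurable (spherical @^-1` A : set (R * R)).
  by move=> mA; have := @measurable_spherical R measurableT _ mA; rewrite setTI.
have h0 p : 0 <= (area_density p)%:E :> \bar R by rewrite lee_fin area_density_ge0.
rewrite integralT_nnsfun sintegralE.
transitivity (\int[mu2]_p (\sum_(k \in range g)
    (k * \1_(g @^-1` [set k]) (spherical p))%:E * (area_density p)%:E)); last first.
  apply: eq_integral => p _; rewrite -ge0_mule_fsuml.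
    by rewrite fsumEFin// -fimfunE.
  by move=> k; exact: nnfun_muleindic_ge0.
have mk (k : R) : measurable_fun [set: R * R]
    (fun p => (\1_(g @^-1` [set k]) (spherical p))%:E : \bar R).
  apply/measurable_EFinP; apply: measurableT_comp; last exact: measurable_spherical.
  exact: measurable_indic.
rewrite ge0_integral_fsum//; last 2 first.
- move=> k; apply: emeasurable_funM; last exact: measurable_area_density.
  under eq_fun do rewrite EFinM.
  by apply: emeasurable_funM; [exact: measurable_cst|exact: mk].
- by move=> k p _; rewrite mule_ge0// nnfun_muleindic_ge0.
apply: eq_fsbigr => k; rewrite inE => -[y _ <-].
under [RHS]eq_integral do rewrite EFinM -muleA.
rewrite ge0_integralZl//.
- congr (_ * _); rewrite /sphere_measure [LHS]integral_mkcond.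
  apply: eq_integral => p _; rewrite patchE /indic.
  rewrite (_ : (p \in _) = (spherical p \in g @^-1` [set g y])).
    by case: ifPn; rewrite ?mul1e ?mul0e.
  by apply/idP/idP; rewrite !inE.
- by apply: emeasurable_funM; [exact: mk|exact: measurable_area_density].
- by move=> p _; rewrite mule_ge0.
- by rewrite lee_fin.
Qed.

(** Monotone convergence, applied to both sides for an increasing approximation by simple
    functions. *)
Lemma ge0_integral_sphere (f : 3.-tuple R -> \bar R) :
  measurable_fun setT f -> (forall y, 0 <= f y) ->
  \int[sph]_y f y = \int[mu2]_p (f (spherical p) * (area_density p)%:E).
Proof.
move=> mf f0; pose g := nnsfun_approx measurableT mf.
have cg y : EFin (g n y) @[n --> \oo] --> f y.
  by apply: cvg_nnsfun_approx => // *; exact: f0.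
have gS y : {homo (fun n => (g n y)%:E) : m n / (m <= n)%N >-> m <= n}.
  by move=> m n mn; rewrite lee_fin; exact/lefP/nd_nnsfun_approx.
transitivity (limn (fun n => \int[sph]_y (g n y)%:E)).
  rewrite -monotone_convergence//.
  - by apply: eq_integral => y _; apply/esym/cvg_lim.
  - by move=> n; exact/measurable_EFinP/measurable_funP.
  - by move=> n y _; rewrite lee_fin.
under eq_fun do rewrite nnsfun_integral_sphere.
rewrite -monotone_convergence//.
- apply: eq_integral => p _; apply/cvg_lim => //.
  by apply: cvgeZr => //; exact: cg.
- move=> n; apply: emeasurable_funM; last exact: measurable_area_density.
  apply/measurable_EFinP; apply: measurableT_comp; last exact: measurable_spherical.
  exact: measurable_funP.
- by move=> n p _; rewrite mule_ge0// lee_fin ?area_density_ge0.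
- move=> p _ m n mn; apply: lee_wpmul2r; rewrite lee_fin; first exact: area_density_ge0.
  exact/lefP/nd_nnsfun_approx.
Qed.

End sphere_integral.

(** * Moments of the sphere; cubature as a condition on monomials *)

Section moments.
Context {R : realType}.
Notation mu := (@lebesgue_measure R).
Notation sph := (@sphere_measure R).
Implicit Types (a b c : nat) (v : 3.-tuple R).

Lemma sphere2E v : sphere2 v <-> dot v v = 1.
Proof.
by rewrite /sphere2/= !big_ord_recr big_ord0/= add0r !(tnth_nth 0) !expr2.
Qed.

Lemma measurable_nth (k : 'I_3) :
  measurable_fun setT (fun v : 3.-tuple R => v`_k).
Proof.
by under eq_fun do rewrite -tnth_nth; exact: measurable_tnth.
Qed.

Lemma measurable_monomial a b c :
  measurable_fun setT (fun v : 3.-tuple R => monomial a b c v).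
Proof.
apply: measurable_funM; [apply: measurable_funM|]; apply: measurable_funX.
- exact: (measurable_nth (Ordinal (isT : 0 < 3)%N)).
- exact: (measurable_nth (Ordinal (isT : 1 < 3)%N)).
- exact: (measurable_nth (Ordinal (isT : 2 < 3)%N)).
Qed.

Lemma measurable_sphere2 : measurable (sphere2 : set (3.-tuple R)).
Proof.
have -> : sphere2 = (fun v : 3.-tuple R => monomial 2 0 0 v + monomial 0 2 0 v
    + monomial 0 0 2 v) @^-1` [set 1].
  apply/seteqP; split=> v /=;
    by rewrite sphere2E /dot /monomial !expr0 !mulr1 !mul1r !expr2.
have mf : measurable_fun setT (fun v : 3.-tuple R => monomial 2 0 0 v
    + monomial 0 2 0 v + monomial 0 0 2 v).
  by do 2![apply: measurable_funD; last exact: measurable_monomial];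
    exact: measurable_monomial.
by have := mf measurableT _ (measurable_set1 1); rewrite setTI.
Qed.

Lemma monomial_le1 a b c v : sphere2 v -> `|monomial a b c v| <= 1.
Proof.
move=> /sphere2E; rewrite /dot -!expr2 => v1.
have [[h0 h1] h2] := (sqr_ge0 (v`_0), sqr_ge0 (v`_1), sqr_ge0 (v`_2)).
have le1 (x : R) n : x ^+ 2 <= 1 -> `|x| ^+ n <= 1.
  move=> ?; rewrite exprn_ile1// -(@ler_pXn2r _ 2)// ?nnegrE//.
  by rewrite expr1n real_normK ?num_real.
rewrite /monomial !normrM !normrX.
by apply: mulr_ile1; rewrite ?mulr_ge0 ?exprn_ge0//; [apply: mulr_ile1|];
  rewrite ?exprn_ge0//; apply: le1; lra.
Qed.

Lemma integrable_monomial a b c :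
  sph.-integrable sphere2 (fun v => (monomial a b c v)%:E).
Proof.
apply: measurable_bounded_integrable.
- exact: measurable_sphere2.
- rewrite -[X in (X < _)%E]/(sphere_measure (sphere2 : set (3.-tuple R))).
  by rewrite sphere_measure_sphere ltry.
- by apply: measurable_funTS; exact: measurable_monomial.
- exists 1; split; rewrite ?num_real// => M M1 v Sv.
  exact: le_trans (monomial_le1 _ _ _ Sv) (ltW M1).
Qed.

Lemma integral_EFin_trig (B k d : R) p q p' q' : 0 <= B ->
  (\int[mu]_(x in `[0%R, B]) (k * trig p q x + d * trig p' q' x)%:E =
   (k * trigint B p q + d * trigint B p' q')%:E)%E.
Proof.
move=> B0.
rewrite /trigint -!RintegralZl//; try exact: continuous_Rintegrable (@continuous_trig _ _ _).
rewrite -RintegralD//; try exact: continuous_Rintegrable (@continuous_trigZ _ _ _ _).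
rewrite /Rintegral fineK//; apply: integrable_fin_num => //.
apply: continuous_Rintegrable => x.
exact: cvgD (@continuous_trigZ _ k p q x) (@continuous_trigZ _ d p' q' x).
Qed.

(** [even_fact (a + b)] cancels between the polar and the azimuthal integral. *)
Lemma trigint_moment a b c :
  trigint (pi : R) (a + b).+1 c * trigint (2 * pi) b a / (4 * pi) = moment a b c.
Proof.
have B0 : 0 < 2 * pi :> R by rewrite mulr_gt0 ?pi_gt0.
rewrite /moment; case: ifPn.
  case/or3P => o.
  - by rewrite (@trigint_cos_odd _ (2 * pi) b a) ?sin2pi// mulr0 mul0r.
  - by rewrite trigint_2pi_sin_odd// mulr0 mul0r.
  - by rewrite (@trigint_cos_odd _ pi _ c) ?pi_gt0 ?sinpi// !mul0r.
rewrite !negb_or => /and3P[ea eb ec].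
rewrite trigint_azimuth// trigint_polar//; last by rewrite oddD (negbTE ea) (negbTE eb).
move: (pi : R) (pi_gt0 R) => P P0; field.
by rewrite odd_fact_neq0 even_fact_neq0 gt_eqF.
Qed.

(** Adding 1 makes the integrand nonnegative on the sphere, as the change of variables and Tonelli
    require. *)
Lemma integral_monomialD1 a b c :
  (\int[sph]_(y in sphere2) (monomial a b c y + 1)%:E = (moment a b c + 1)%:E)%E.
Proof.
have pi0 := pi_gt0 R; have pi4 : 4 * pi != 0 :> R by rewrite gt_eqF ?mulr_gt0.
have pi2 : 0 < 2 * pi :> R by rewrite mulr_gt0.
rewrite integral_mkcond; set f := _ \_ _.
have mf : measurable_fun setT f.
  apply/(measurable_restrictT _ measurable_sphere2)/measurable_EFinP/measurable_funTS.
  by apply: measurable_funD => //; exact: measurable_monomial.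
have f0 y : (0 <= f y)%E.
  rewrite /f patchE; case: ifPn => // /set_mem Sy.
  by rewrite lee_fin; have := monomial_le1 a b c Sy; rewrite ler_norml => /andP[]; lra.
rewrite ge0_integral_sphere//.
rewrite fubini_tonelli1; last 2 first.
- apply: emeasurable_funM; last exact: measurable_area_density.
  exact: (measurableT_comp mf measurable_spherical).
- by move=> p; rewrite mule_ge0// lee_fin area_density_ge0.
(* The added 1 contributes 2 pi / (4 pi) times sin x. *)
transitivity (\int[mu]_(x in `[0%R, pi])
   (trigint (2 * pi) b a / (4 * pi) * trig (a + b).+1 c x + 2^-1 * trig 1 0 x)%:E)%E.
  rewrite [RHS]integral_mkcond; apply: eq_integral => x _.
  rewrite /fubini_F /f patchE /=.
  case: ifPn => xpi; last first.
    rewrite integral0_eq// => y _; rewrite /area_density patchE ifN ?mule0//.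
    by apply: contra xpi; rewrite !inE /angle_box /= => -[].
  transitivity (\int[mu]_(y in `[0%R, (2 * pi)%R])
     (trig (a + b).+1 c x / (4 * pi) * trig b a y + sin x / (4 * pi) * trig 0 0 y)%:E)%E.
    rewrite [RHS]integral_mkcond; apply: eq_integral => y _.
    rewrite /area_density !patchE /angle_box in_setX /= xpi /=.
    rewrite (mem_set (spherical_sphere _)).
    case: (_ \in _); last by rewrite mule0.
    rewrite -EFinM; congr EFin; rewrite /monomial /trig /= !exprMn.
    rewrite exprS exprD; move: (pi : R) pi4 => P P4; field.
    by apply: contra P4 => /eqP ->; rewrite mulr0.
  rewrite integral_EFin_trig ?ltW//; congr EFin.
  rewrite trigint_2pi_00 /trig expr0 expr1 mulr1 [_ c x / _ * _]mulrAC.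
  move: (trigint _ _ _) => I; move: (pi : R) pi0 => P P0; field.
  by rewrite gt_eqF.
rewrite integral_EFin_trig ?ltW// trigint10 -trigint_moment; congr EFin.
move: (trigint _ _ _) => I; move: (trigint _ _ _) => J.
move: (pi : R) pi0 => P P0; field.
by rewrite gt_eqF.
Qed.

Lemma integral_monomial a b c :
  (\int[sph]_(y in sphere2) (monomial a b c y)%:E = (moment a b c)%:E)%E.
Proof.
have := integral_monomialD1 a b c.
under eq_integral do rewrite EFinD.
rewrite integralD//=; last 3 first.
- exact: measurable_sphere2.
- exact: integrable_monomial.
- have := integrable_monomial 0 0 0.
  apply: eq_integrable => [|v _]; first exact: measurable_sphere2.
  by rewrite /monomial !expr0 !mulr1.
rewrite integral_cst ?mul1e; last exact: measurable_sphere2.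
rewrite -[X in (_ + X)%E]/(sphere_measure (sphere2 : set (3.-tuple R))).
rewrite sphere_measure_sphere.
by case: (\int[_]_(_ in _) _)%E => [r||] //= [/addIr ->].
Qed.

Let o0 : 'I_3 := ord0.
Let o1 : 'I_3 := lift ord0 ord0.
Let o2 : 'I_3 := lift ord0 (lift ord0 ord0).

Lemma prod_monomial v (m : multinom 3) :
  \prod_(i < 3) tnth v i ^+ m i = monomial (m o0) (m o1) (m o2) v.
Proof. by rewrite !big_ord_recl big_ord0 mulr1 mulrA !(tnth_nth 0). Qed.

Lemma integral_meval (f : mpoly 3 R) :
  (\int[sph]_(y in sphere2) (meval (tnth y) f)%:E =
   (\sum_(m <- msupp f) mcoeff m f * moment (m o0) (m o1) (m o2))%:E)%E.
Proof.
have mS := @measurable_sphere2; have im := integrable_monomial.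
under eq_integral.
  move=> v _; rewrite mevalE; under eq_bigr do rewrite prod_monomial.
  rewrite -sumEFin; under eq_bigr do rewrite EFinM; over.
rewrite integral_sum//; last by move=> m; exact: integrableZl.
rewrite -sumEFin; apply: eq_bigr => m _.
by rewrite integralZl// integral_monomial EFinM.
Qed.

(** By linearity it suffices to integrate monomials; this links the measure to the algebraic
    arguments above. *)
Lemma positive_cubatureP t N (x : 'I_N -> 3.-tuple R) (w : 'I_N -> R) :
  positive_cubature t x w <->
  [/\ injective x, forall i, sphere2 (x i), forall i, 0 < w i &
   forall a b c, (a + b + c <= t)%N ->
     \sum_(i < N) w i * monomial a b c (x i) = moment a b c].
Proof.
split=> -[xI xS w0 H]; split=> //.
- move=> a b c abc; pose m : multinom 3 := Multinom [tuple a; b; c].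
  have dm : mdeg m = (a + b + c)%N.
    rewrite mdegE !big_ord_recl big_ord0 /= !multinomE !(tnth_nth 0%N) /=.
    by rewrite addn0 addnA.
  have := H (mpolyX R m); rewrite msizeX dm ltnS abc => /(_ isT).
  rewrite integral_meval => -[].
  rewrite msuppX big_seq1 mcoeffX eqxx mul1r !multinomE !(tnth_nth 0%N) /= => ->.
  apply: eq_bigr => i _; rewrite mevalX prod_monomial.
  by rewrite !multinomE !(tnth_nth 0%N).
- move=> f ft; rewrite integral_meval; congr EFin.
  under [RHS]eq_bigr do rewrite mevalE big_distrr.
  rewrite exchange_big /=; rewrite big_seq [RHS]big_seq; apply: eq_bigr => m mf.
  have dm : (m o0 + m o1 + m o2 <= t)%N.
    have := msize_mdeg_lt mf; rewrite mdegE !big_ord_recl big_ord0 addn0 addnA => h.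
    by have := leq_trans h ft.
  rewrite -(H _ _ _ dm) mulr_sumr; apply: eq_bigr => i _.
  by rewrite prod_monomial mulrCA.
Qed.

End moments.

(** * The least number of nodes *)

Lemma has_positive_cubature32 (R : realType) : has_positive_cubature R 9 32.
Proof.
have c32 : #|{: node_index}| = 32%N.
  by rewrite card_sum !card_prod !card_bool card_ord.
pose h (i : 'I_32) : node_index := enum_val (cast_ord (esym c32) i).
exists (fun i => node (h i)), (fun i => weight (h i)).
apply/positive_cubatureP; split.
- by move=> i j /node_inj /enum_val_inj /cast_ord_inj.
- by move=> i; apply/sphere2E; exact: node_sphere.
- by move=> i; exact: weight_gt0.
move=> a b c abc; rewrite -(node_cubature abc) [RHS](reindex h)//=.
exists (fun k => cast_ord c32 (enum_rank k)) => i _.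
  by rewrite /h enum_valK cast_ordKV.
by rewrite /h cast_ordK enum_rankK.
Qed.

Lemma positive_cubature_ge32 (R : realType) N :
  has_positive_cubature R 9 N -> (32 <= N)%N.
Proof.
case=> x [w /positive_cubatureP[xI xS w0 xw]]; rewrite leqNgt; apply/negP => N31.
apply: (@cubature_contradiction R N (fun i => x i) w) => // [i|i j xij].
  by apply/sphere2E.
apply/xI/eq_from_tnth => k; rewrite !(tnth_nth 0).
have [xi xj] : dot (x i) (x i) = 1 /\ dot (x j) (x j) = 1 by split; apply/sphere2E.
(* |x_i - x_j|^2 = 1 + 1 - 2 = 0. *)
pose s := [:: (x i)`_0 - (x j)`_0; (x i)`_1 - (x j)`_1; (x i)`_2 - (x j)`_2].
have : dot s s = 0.
  transitivity (dot (x i) (x i) + dot (x j) (x j) - dot (x i) (x j) *+ 2).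
    by rewrite /s /dot /=; ring.
  by rewrite xi xj xij; ring.
move/eqP; rewrite dot_eq0 /= !subr_eq0 => /and3P[/eqP x0 /eqP x1 /eqP x2].
by case: k => -[|[|[|//]]].
Qed.

Theorem corollary4p4 (R : realType) : min_nodes R 9 = 32%N.
Proof.
(* [xget] takes its default only if there is no minimum, but 32 is one. *)
rewrite /min_nodes; case: xgetP => [N _ [hN minN]|no].
  apply/eqP; rewrite eqn_leq (minN _ (has_positive_cubature32 R)).
  exact: positive_cubature_ge32 hN.
case: (no 32%N); split; first exact: has_positive_cubature32.
by move=> M; exact: positive_cubature_ge32.
Qed.
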